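(* For any $u_0\in C_b(\bar\Omega)$ and any $\varphi\in C_b(\partial^\mu\Omega\times[0,\infty))$ with $u_0=\varphi(\cdot,0)$ on $\partial\Omega\cap\partial^\mu\Omega$, there exists a unique solution $u\in X=C_b(\bar\Omega\times[0,\infty))$ of the Dirichlet problem $(\mathcal P)$ with initial data $u_0$ and boundary data $\varphi$.
   Context: $\Omega\subset\mathbb{R}^n$ is open, bounded, connected and regular (i.e. with smooth boundary). $\mu\in L^1(\mathbb{R}^n)$ is a nonnegative function with $\int_{\mathbb{R}^n}\mu(z)\,dz=1$; the symbol $\mu$ also denotes the measure $d\mu(z)=\mu(z)\,dz$. $C_b(Y)$ is the set of bounded continuous real-valued functions on $Y$, and $X=C_b(\bar\Omega\times[0,\infty))$. The domain of influence of $\Omega$ is $\bar\Omega^\mu=\overline{\bigcup_{x\in\Omega}(x+\mathrm{supp}\,\mu)}$, and the extended frontier is $\partial^\mu\Omega=\bar\Omega^\mu\setminus\Omega$. Define the nonlocal operator $$K_\varphi(u)(x,t)=\int_{\{z:\,x+z\in\Omega\}}u(x+z,t)\,d\mu(z)+\int_{\{z:\,x+z\in\partial^\mu\Omega\}}\varphi(x+z,t)\,d\mu(z)-u(x,t).$$ A solution of the Dirichlet problem $(\mathcal P)$ with initial data $u_0$ and boundary data $\varphi$ is a function $u\in C(\Omega\times[0,\infty))$ such that $\partial_t u=K_\varphi(u)$ in $\Omega\times(0,\infty)$ in the sense of distributions and $u(\cdot,0)=u_0$ in $\Omega$. *)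

(* Defs.v *)
From HB Require Import structures.
From mathcomp Require Import all_boot all_order all_algebra.
From mathcomp Require Import all_classical all_reals all_analysis.
From mathcomp Require Import measurable_realfun.

Set Implicit Arguments.
Unset Strict Implicit.
Unset Printing Implicit Defensive.

Import Order.TTheory GRing.Theory Num.Theory.
Import numFieldNormedType.Exports.

Local Open Scope classical_set_scope.
Local Open Scope ring_scope.

(* R^n is 'rV[R]_n, equipped with its Borel sigma-algebra. *)
Section borel_rV.
Context {R : realType}.

HB.instance Definition _ (m n : nat) :=
  @isMeasurable.Build default_measure_display 'M[R]_(m, n)
    <<s @open 'M[R]_(m, n) >> (@sigma_algebra0 _ setT _)
    (@sigma_algebraC _ _) (@sigma_algebra_bigcup _ setT _).

Lemma open_measurable_rV n (A : set 'rV[R]_n) : open A -> measurable A.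
Proof. exact: sub_sigma_algebra. Qed.

Let box n (q r : 'rV[rat]_n) : set 'rV[R]_n :=
  [set v | forall i, ratr (q 0 i) < v 0 i < ratr (r 0 i)].

Lemma open_rV_bigcup_box n (A : set 'rV[R]_n) : open A ->
  A = \bigcup_(p in [set p : 'rV[rat]_n * 'rV[rat]_n | box p.1 p.2 `<=` A])
        box p.1 p.2.
Proof.
move=> oA; apply/seteqP; split => [v Av|v [p /= pA]]; last exact: pA.
have /nbhs_ballP[e /= e0 veA] : nbhs v A by exact: open_nbhs_nbhs.
have hq i : exists q : rat, v 0 i - e < ratr q < v 0 i.
  have /rat_in_itvoo[q] : v 0 i - e < v 0 i by rewrite ltrBlDr ltrDl.
  by rewrite in_itv/=; exists q.
have hr i : exists r : rat, v 0 i < ratr r < v 0 i + e.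
  have /rat_in_itvoo[r] : v 0 i < v 0 i + e by rewrite ltrDl.
  by rewrite in_itv/=; exists r.
have [q Hq] := choice hq; have [r Hr] := choice hr.
exists (\row_i q i, \row_i r i) => /=; last first.
  by move=> i; rewrite !mxE; have /andP[_ ->] := Hq i; have /andP[-> _] := Hr i.
move=> w /= Hw; apply: veA; split => // i j; rewrite ord1 /ball /= distrC.
have := Hw j; rewrite !mxE => /andP[w1 w2].
have /andP[q1 q2] := Hq j; have /andP[r1 r2] := Hr j.
rewrite ltr_distl (lt_trans q1 w1)/=; exact: lt_trans r2.
Qed.

Lemma measurable_fun_rV d (T : measurableType d) n (f : T -> 'rV[R]_n) :
  (forall i, measurable_fun setT (fun x => f x 0 i)) -> measurable_fun setT f.
Proof.
move=> mf; apply: (measurability (@open 'rV[R]_n)) => // _ [A oA <-].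
rewrite setTI (open_rV_bigcup_box oA) preimage_bigcup.
rewrite bigcup_mkcond; apply: countable_bigcupT_measurable => [|p].
  exact: countableP.
case: ifPn => // _.
rewrite (_ : _ @^-1` _ = \bigcap_(i in [set: 'I_n])
    ((fun x => f x 0 i) @^-1` `]ratr (p.1 0 i), ratr (p.2 0 i)[)); last first.
  apply/seteqP; split => x /= H i; first by move=> _ /=; rewrite in_itv/=.
  by have := H i I; rewrite /= in_itv/=.
apply: fin_bigcap_measurable; first exact: finite_finset.
by move=> i _; rewrite -[X in measurable X]setTI; exact: mf.
Qed.

Lemma measurable_coord n (i : 'I_n) :
  measurable_fun setT (fun v : 'rV[R]_n => v 0 i).
Proof.
apply: (measurability _ (RGenOInfty.measurableE R)) => // _ [_ [a ->] <-].
rewrite setTI; apply: open_measurable_rV.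
rewrite set_itvoy; apply: open_comp; last exact: open_gt.
by move=> v _; exact: coord_continuous.
Qed.

End borel_rV.

Section lebesgue_rV.
Context {R : realType}.

Definition cons_rV n (p : measurableTypeR R * 'rV[R]_n) : 'rV[R]_n.+1 :=
  row_mx (\row_(_ < 1) p.1) p.2.

Lemma measurable_cons_rV n : measurable_fun setT (@cons_rV n).
Proof.
apply: measurable_fun_rV => i; case: (@split_ordP 1 n i) => k ->.
  rewrite (_ : (fun _ => _) = fst); first exact: measurable_fst.
  by apply/funext => p; rewrite (row_mxEl (\row_(_ < 1) p.1) p.2) mxE.
rewrite (_ : (fun _ => _) = (fun v : 'rV[R]_n => v 0 k) \o snd).
  exact: (measurableT_comp (measurable_coord k) measurable_snd).
by apply/funext => p; exact: (row_mxEr (\row_(_ < 1) p.1) p.2).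
Qed.

Let uncons_rV n (v : 'rV[R]_n.+1) : measurableTypeR R * 'rV[R]_n :=
  (v 0 0, \row_i v 0 (lift 0 i)).

Let cons_rVK n : cancel (@cons_rV n) (@uncons_rV n).
Proof.
move=> [x v]; rewrite /uncons_rV /cons_rV /=; congr (_, _).
  rewrite (_ : 0 = lshift n (0 : 'I_1) :> 'I_(1 + n)); last exact/val_inj.
  by rewrite (row_mxEl (\row_(_ < 1) x) v) mxE.
apply/rowP => i; rewrite mxE.
rewrite (_ : lift 0 i = rshift 1 i :> 'I_(1 + n)); last exact/val_inj.
exact: (row_mxEr (\row_(_ < 1) x) v).
Qed.

Let measurable_uncons_rV n : measurable_fun setT (@uncons_rV n).
Proof.
apply: measurable_fun_pair; first exact: measurable_coord.
apply: measurable_fun_rV => i; under eq_fun do rewrite mxE.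
exact: measurable_coord.
Qed.

Section step.
Variables (n : nat) (m : {sigma_finite_measure set 'rV[R]_n -> \bar R}).

Definition lebesgue_rV_step : set 'rV[R]_n.+1 -> \bar R :=
  pushforward (lebesgue_measure \x m)%E (@cons_rV n).

Let step0 : lebesgue_rV_step set0 = 0%E.
Proof. by rewrite /lebesgue_rV_step /pushforward preimage_set0 measure0. Qed.

Let step_ge0 A : (0 <= lebesgue_rV_step A)%E.
Proof. exact: (measure_ge0 (lebesgue_measure \x m)%E). Qed.

Let step_sigma_additive : semi_sigma_additive lebesgue_rV_step.
Proof.
have mcons A : measurable A -> measurable (@cons_rV n @^-1` A).
  by move=> mA; rewrite -[X in measurable X]setTI; exact: measurable_cons_rV.
move=> F mF tF mUF; rewrite /lebesgue_rV_step /pushforward preimage_bigcup.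
apply: (measure_semi_sigma_additive (s := (lebesgue_measure \x m)%E))
  => [i||]; first exact: mcons.
  apply/trivIsetP => /= i j _ _ ij; rewrite -preimage_setI.
  by move/trivIsetP : tF => /(_ _ _ _ _ ij) ->//; rewrite preimage_set0.
by rewrite -preimage_bigcup; exact: mcons.
Qed.

HB.instance Definition _ := isMeasure.Build _ _ _ lebesgue_rV_step
  step0 step_ge0 step_sigma_additive.

Let step_sigma_finite : sigma_finite setT lebesgue_rV_step.
Proof.
have /sigma_finiteP[F [FT ndF mF]] := sigma_finiteT (@lebesgue_measure R).
have /sigma_finiteP[G [GT ndG mG]] := sigma_finiteT m.
exists (fun k => @uncons_rV n @^-1` (F k `*` G k)).
  rewrite -preimage_bigcup; apply/esym; rewrite -[RHS](preimage_setT (@uncons_rV n)).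
  congr (_ @^-1` _); apply/seteqP; split => // -[x v] _.
  have [i _ Fix] : (\bigcup_i F i) x by rewrite -FT.
  have [j _ Gjv] : (\bigcup_j G j) v by rewrite -GT.
  exists (maxn i j) => //; split.
    by move: x Fix; exact/subsetPset/ndF/leq_maxl.
  by move: v Gjv; exact/subsetPset/ndG/leq_maxr.
move=> k; have [mFk Fk] := mF k; have [mGk Gk] := mG k; split.
  rewrite -[X in measurable X]setTI; apply: measurable_uncons_rV => //.
  exact: measurableX.
rewrite /= /lebesgue_rV_step /pushforward -comp_preimage.
rewrite (_ : _ \o _ = id); last by apply/funext => p /=; exact: cons_rVK.
by rewrite preimage_id product_measure1E// lte_mul_pinfty// ge0_fin_numE.
Qed.

HB.instance Definition _ := Measure_isSigmaFinite.Build _ _ _ lebesgue_rV_step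
  step_sigma_finite.

End step.

(* The n-dimensional Lebesgue measure, as the iterated product of the
   one-dimensional one. *)
Fixpoint lebesgue_rV n : {sigma_finite_measure set 'rV[R]_n -> \bar R} :=
  match n with
  | 0%N => \d_(0 : 'rV[R]_0)
  | n.+1 => lebesgue_rV_step (lebesgue_rV n)
  end.

End lebesgue_rV.

Section smooth.
Context {R : realType} {V : normedModType R}.

(* [:: v1; ...; vk] is sent to 'D_v1 ('D_v2 (... ('D_vk f))). *)
Definition iter_derive (s : seq V) (f : V -> R) : V -> R :=
  foldr (fun v g => 'D_v g) f s.

(* C^infinity on the open set U of a finite-dimensional V: directional
   derivatives of every order exist and are continuous on U. *)
Definition smooth_on (U : set V) (f : V -> R) : Prop :=
  forall s : seq V, forall x, U x ->
    {for x, continuous (iter_derive s f)} /\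
    forall v, derivable (iter_derive s f) x v.

Definition boundary (A : set V) : set V := closure A `\` interior A.

(* Near each boundary point, Omega is the strict sublevel set of a smooth
   function whose differential does not vanish at that point. *)
Definition smooth_boundary (Omega : set V) : Prop :=
  forall p, boundary Omega p -> exists (U : set V) (g : V -> R),
    [/\ open U, U p, smooth_on U g, exists v, 'D_v g p != 0 &
        forall x, U x -> (Omega x <-> g x < 0)].

Definition regular_domain (Omega : set V) : Prop :=
  [/\ open Omega, bounded_set Omega, connected Omega & smooth_boundary Omega].

End smooth.

Section bounded_continuous.
Context {R : realType} {T : topologicalType}.

(* C_b(Y); functions are total and only their values on Y matter. *)
Definition Cb (Y : set T) (f : T -> R) : Prop :=
  {within Y, continuous f} /\ [bounded f x | x in Y].

End bounded_continuous.

Section nonlocal_dirichlet.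
Context {R : realType} {n : nat}.
Local Notation Rn := 'rV[R]_n.
Implicit Types (mu : Rn -> R) (Omega : set Rn) (u phi psi : Rn * R -> R).

Definition is_density mu : Prop :=
  [/\ (lebesgue_rV n).-integrable setT (EFin \o mu),
      forall z, 0 <= mu z &
      (\int[lebesgue_rV n]_z (mu z)%:E = 1)%E].

(* The support of the measure mu(z) dz. *)
Definition supp mu : set Rn :=
  [set z | forall U : set Rn, open U -> U z ->
    (0 < \int[lebesgue_rV n]_(y in U) (mu y)%:E)%E].

Definition influence mu Omega : set Rn :=
  closure (\bigcup_(x in Omega) [set x + z | z in supp mu]).

Definition ext_frontier mu Omega : set Rn := influence mu Omega `\` Omega.

Definition nonlocal_op mu Omega phi u : Rn * R -> R := fun p =>
  let: (x, t) := p in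
  \int[lebesgue_rV n]_(z in [set z | Omega (x + z)]) (u (x + z, t) * mu z)
  + \int[lebesgue_rV n]_(z in [set z | ext_frontier mu Omega (x + z)])
      (phi (x + z, t) * mu z)
  - u (x, t).

Definition test_function (D : set (Rn * R)) psi : Prop :=
  [/\ smooth_on setT psi,
      compact (closure [set p | psi p != 0]) &
      closure [set p | psi p != 0] `<=` D].

Definition space_time : {measure set (Rn * measurableTypeR R) -> \bar R} :=
  (lebesgue_rV n \x lebesgue_measure)%E.

(* d/dt u = w in the sense of distributions on the open set D; 'D_(0, 1) is
   the time derivative. *)
Definition distr_dt_eq (D : set (Rn * R)) (u w : Rn * R -> R) : Prop :=
  forall psi, test_function D psi ->
    - (\int[space_time]_(p in D) (u p * 'D_(0 : Rn, 1 : R) psi p)) =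
    \int[space_time]_(p in D) (w p * psi p).

Definition dirichlet_solution mu Omega (u0 : Rn -> R) phi u : Prop :=
  [/\ {within Omega `*` `[0, +oo[, continuous u},
      distr_dt_eq (Omega `*` `]0, +oo[) u (nonlocal_op mu Omega phi u) &
      forall x, Omega x -> u (x, 0) = u0 x].

End nonlocal_dirichlet.

(* Main.v *)
Require Import Defs.
From mathcomp Require Import all_boot all_order all_algebra.
From mathcomp Require Import all_classical all_reals all_analysis.
From mathcomp Require Import measurable_realfun ring lra.

Set Implicit Arguments.
Unset Strict Implicit.
Unset Printing Implicit Defensive.

Import Order.TTheory GRing.Theory Num.Theory.
Import numFieldNormedType.Exports.

Local Open Scope classical_set_scope.
Local Open Scope ring_scope.

(** On a fixed point x of Omega the equation is an ordinary differential
    equation in t, so everything is reduced to the integrated (mild) form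
      u(x,t) = u0(x) + int_0^t K_phi(u)(x,s) ds.

    Regularity of the operator. The function obtained by gluing u on Omega and
    phi on the extended frontier may jump across the boundary of Omega, but this
    does not spoil the continuity of K_phi(u) in x, because the smooth boundary
    has Lebesgue measure zero: near a boundary point the defining function g is
    strictly monotone along some direction v, so infinitely many small
    translates along v of a piece of the boundary are disjoint and lie in a
    bounded set, and translation invariance forces the piece to be null
    ([smooth_boundary_negligible]). Moreover, for x in the closure of Omega and
    almost every z for the measure mu, the point x + z stays in the domain of
    influence. Dominated convergence then gives continuity on the closure of
    Omega ([seqcont_avg_domain], [seqcont_avg_ext]).

    Existence. With z = e^t u the damping term disappears and the mild equation
    becomes z = u0 + int_0^t (J z + e^s b), where J is the average over Omega
    and b the contribution of phi. If M bounds u0 and phi, the set of continuous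
    z with |z| <= M e^t is stable, because the masses that mu gives to the two
    regions sum to at most 1, and the map contracts by 1/2 in the norm
    sup e^(-2t) |z|; its fixed point ([exists_mild]) gives a solution u bounded
    by M, globally in time. Being classical in t, it is a solution in the sense
    of distributions by Fubini and integration by parts ([classical_distr]).

    Uniqueness. Conversely a continuous distributional solution v is mild
    ([distr_mild]): W(x,t) = v(x,t) - int_0^t K_phi(v)(x,s) ds has zero
    distributional time derivative, and if W(x,.) took two different values at
    times a < b, a smooth test function concentrated near x whose time
    derivative is positive near a and negative near b would detect it. The
    difference d of two mild solutions satisfies a Gronwall inequality: a bound
    |d| <= N e^(4t) improves to N/2 e^(4t), hence d = 0 on Omega, and on its
    closure by continuity ([solution_unique]). *)

(** * Lebesgue measure of boxes and its translation invariance *)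

Lemma cons_rV0 (R : realType) n (p : measurableTypeR R * 'rV[R]_n) :
  cons_rV p 0 0 = p.1.
Proof.
rewrite (_ : cons_rV p 0 0 = cons_rV p 0 (lshift n (0 : 'I_1))).
  by rewrite (row_mxEl (\row_(_ < 1) p.1) p.2) mxE.
by congr (cons_rV p _ _); exact/val_inj.
Qed.

Lemma cons_rVS (R : realType) n (p : measurableTypeR R * 'rV[R]_n) i :
  cons_rV p 0 (lift 0 i) = p.2 0 i.
Proof.
rewrite (_ : cons_rV p 0 (lift 0 i) = cons_rV p 0 (rshift 1 i)).
  exact: (row_mxEr (\row_(_ < 1) p.1) p.2).
by congr (cons_rV p _ _); exact/val_inj.
Qed.

Lemma ler_coord_norm (R : realType) n (v : 'rV[R]_n) i : `|v 0 i| <= `|v|.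
Proof.
rewrite -[leRHS]/(mx_norm v) mx_normrE.
exact: (le_bigmax _ (fun ij : 'I_1 * 'I_n => `|v ij.1 ij.2|) (0, i)).
Qed.

Lemma closed_measurable_rV (R : realType) n (A : set 'rV[R]_n) :
  closed A -> measurable A.
Proof.
move=> cA; rewrite -[A]setCK; apply: measurableC.
by apply: open_measurable_rV; exact: closed_openC.
Qed.

Definition boxo (R : realType) n (a b : 'rV[R]_n) : set 'rV[R]_n :=
  [set v | forall i, a 0 i < v 0 i < b 0 i].

Lemma open_boxo (R : realType) n (a b : 'rV[R]_n) : open (boxo a b).
Proof.
rewrite openE => v vab; exists (fun=> fun j => `]a 0 j, b 0 j[%classic) => /=.
  move=> i j; rewrite ord1; apply: open_nbhs_nbhs; split => //.
  by rewrite /= in_itv/= vab.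
by move=> w H i; have := H 0 i; rewrite /= in_itv.
Qed.

(** Used in two directions: nonempty boxes have positive measure and bounded
    sets have finite measure. *)
Lemma lebesgue_rV_box (R : realType) n (a b : 'rV[R]_n) :
  (forall i, a 0 i <= b 0 i) ->
  lebesgue_rV n (boxo a b) = (\prod_i (b 0 i - a 0 i))%:E.
Proof.
elim: n a b => [|n IH] a b ab.
  rewrite /= diracE big_ord0 mem_set//= => -[].
  by case.
rewrite /= /lebesgue_rV_step /pushforward.
pose a' := \row_(i < n) a 0 (lift 0 i); pose b' := \row_(i < n) b 0 (lift 0 i).
rewrite (_ : _ @^-1` _ = `]a 0 0, b 0 0[ `*` boxo a' b'); last first.
  apply/seteqP; split => -[x v] /=.
    move=> H; split.
      by have := H 0; rewrite in_itv/= cons_rV0.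
    by move=> i; have := H (lift 0 i); rewrite cons_rVS !mxE.
  move=> [H1 H2] i; case: (unliftP 0 i) => [j|] ->.
    by rewrite cons_rVS; have := H2 j; rewrite !mxE.
  by move: H1; rewrite in_itv/= cons_rV0.
have mb := open_measurable_rV (@open_boxo _ _ a' b').
rewrite product_measure1E//.
rewrite IH; last by move=> i; rewrite !mxE.
rewrite [X in (X * _)%E](_ : _ = lebesgue_measure `]a 0 0, b 0 0[%classic)//.
rewrite lebesgue_measure_itv big_ord_recl/= lte_fin.
under eq_bigr do rewrite !mxE.
have := ab 0; rewrite le_eqVlt => /predU1P[->|->]; last first.
  by rewrite EFinM EFinB.
by rewrite ltxx mul0e subrr mul0r.
Qed.

Lemma lebesgue_measure_shift (R : realType) (a : R) (A : set R) : measurable A ->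
  lebesgue_measure ((fun x : R => x + a) @^-1` A) = lebesgue_measure A.
Proof.
have ms : measurable_fun setT ((fun x : R => x + a) : measurableTypeR R -> measurableTypeR R).
  by apply: measurable_funD.
move=> mA.
rewrite -[LHS]/(pushforward lebesgue_measure
  ((fun x : R => x + a) : _ -> measurableTypeR R) A).
apply/esym/lebesgue_measure_unique => //= _ [[c b]] _ <-; rewrite /pushforward.
rewrite (_ : _ @^-1` _ = `]c - a, b - a]%classic); last first.
  by apply/seteqP; split => x /=; rewrite !in_itv/= ltrBlDr lerBrDr.
by rewrite !lebesgue_measure_itv/= !lte_fin ltrD2r -!EFinB; case: ifP => // _; congr EFin; ring.
Qed.

Lemma measurable_shift_rV (R : realType) n (a : 'rV[R]_n) :
  measurable_fun setT (fun v : 'rV[R]_n => v + a).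
Proof.
apply: measurable_fun_rV => i.
under eq_fun do rewrite mxE.
apply: measurable_funD => //; exact: measurable_coord.
Qed.

(** Through [cons_rV] a translation acts separately on the first coordinate and
    on the others, and a product measure is determined by its values on
    rectangles, so the claim follows by induction on the dimension. *)
Lemma lebesgue_rV_shift (R : realType) n (a : 'rV[R]_n) (A : set 'rV[R]_n) :
  measurable A -> lebesgue_rV n ((fun v => v + a) @^-1` A) = lebesgue_rV n A.
Proof.
elim: n a A => [|n IH] a A mA.
  rewrite (_ : _ @^-1` _ = A)//; apply/seteqP; split => x /=;
    by rewrite (_ : x + a = x)//; apply/rowP => -[].
rewrite /= /lebesgue_rV_step /pushforward.
pose a' := \row_(i < n) a 0 (lift 0 i).
pose s (p : measurableTypeR R * 'rV[R]_n) : measurableTypeR R * 'rV[R]_n :=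
  (p.1 + a 0 0, p.2 + a').
have ms : measurable_fun setT s.
  apply: measurable_fun_pair.
    by apply: measurable_funD => //; exact: measurable_fst.
  exact: (measurableT_comp (measurable_shift_rV a') measurable_snd).
set B := @cons_rV R n @^-1` A.
have mB : measurable B.
  by rewrite -[X in measurable X]setTI; exact: measurable_cons_rV.
rewrite (_ : _ @^-1` _ = s @^-1` B); last first.
  apply/seteqP; split => p /=; rewrite /B/= (_ : cons_rV p + a = cons_rV (s p))//;
  apply/rowP => i; rewrite mxE; (case: (unliftP 0 i) => [j|] ->;
    [by rewrite !cons_rVS/= !mxE|by rewrite !cons_rV0]).
apply/esym.
rewrite -[RHS]/(pushforward (lebesgue_measure \x lebesgue_rV n)%E s B).
apply: product_measure_unique => // C D mC mD; rewrite /= /pushforward.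
rewrite (_ : _ @^-1` _ = ((fun x : R => x + a 0 0) @^-1` C) `*` ((fun v => v + a') @^-1` D))//.
rewrite product_measure1E//.
- congr (_ * _)%E; [exact: lebesgue_measure_shift|exact: IH].
- rewrite -[X in measurable X]setTI; apply: measurable_funD => //.
- by rewrite -[X in measurable X]setTI; exact: measurable_shift_rV.
Qed.

(** * Sequential continuity, measurability and integration *)

Section sequential_continuity.
Context {R : realType}.

(** Continuity relative to S, in the form that the dominated convergence theorem
    for sequences consumes and produces; it agrees with the topological notion
    on pseudometric spaces. *)
Definition seqcont (T : topologicalType) (S : set T) (f : T -> R) :=
  forall (x : nat -> T) p, (forall k, S (x k)) -> S p -> x @ \oo --> p ->
    f (x k) @[k --> \oo] --> f p.

Lemma within_continuous_seqcont (T : topologicalType) (S : set T) (f : T -> R) :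
  {within S, continuous f} -> seqcont S f.
Proof.
move=> /subspace_continuousP cf x p Sx Sp xp.
apply: cvg_trans (cf p Sp) => A Ap.
have := xp _ Ap; rewrite /nbhs/=.
by apply: filterS => k; exact.
Qed.

Lemma cvg_inv_ball (T : pseudoMetricType R) (x : nat -> T) (p : T) :
  (forall k, ball p k.+1%:R^-1 (x k)) -> x @ \oo --> p.
Proof.
move=> xp; apply/cvg_ballP => d d0; near=> k; apply: le_ball (xp k).
by near: k; have := near_infty_natSinv_lt (PosNum d0); apply: filterS => k /ltW.
Unshelve. all: by end_near. Qed.

Lemma closure_seq (T : pseudoMetricType R) (S : set T) (p : T) :
  closure S p -> exists x : nat -> T, (forall k, S (x k)) /\ x @ \oo --> p.
Proof.
move=> clp.
have hx (k : nat) : exists y, S y /\ ball p k.+1%:R^-1 y.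
  have [y [Sy py]] := clp _ (nbhsx_ballx p _ (divr_gt0 ltr01 (ltr0Sn R k))).
  by exists y; split => //; rewrite -div1r.
have [x hx'] := choice hx; exists x; split => [k|]; first by have [] := hx' k.
by apply: cvg_inv_ball => k; have [] := hx' k.
Qed.

Lemma seqcont_within_continuous (T : pseudoMetricType R) (S : set T)
    (f : T -> R) :
  seqcont S f -> {within S, continuous f}.
Proof.
move=> cf; apply/subspace_continuousP => p Sp.
apply/cvgrPdist_lt => e e0; apply: contrapT => nf.
have hx (k : nat) : exists y, [/\ S y, ball p k.+1%:R^-1 y & e <= `|f p - f y|].
  apply: contrapT => ny; apply: nf.
  have : \forall y \near p, ball p k.+1%:R^-1 y by apply: nbhsx_ballx.
  apply: filterS => y /= py Sy; rewrite ltNge; apply/negP => ey.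
  by apply: ny; exists y.
have [x hx'] := choice hx.
have xp : x @ \oo --> p.
  by apply: cvg_inv_ball => k; have [] := hx' k.
have /cvgrPdist_lt/(_ e e0)[N _ /(_ N)] := cf x p (fun k => let: And3 a _ _ := hx' k in a) Sp xp.
move=> /(_ (leqnn N)) /=; have [_ _] := hx' N.
by rewrite ltNge => ->.
Qed.

Lemma continuous_seqcont (T : topologicalType) (S : set T) (f : T -> R) :
  continuous f -> seqcont S f.
Proof. by move=> cf; apply: within_continuous_seqcont; exact: continuous_subspaceT. Qed.

Lemma seqcont_nbhs (T : pseudoMetricType R) (S : set T) (f : T -> R) (p : T) :
  seqcont S f -> nbhs p S -> {for p, continuous f}.
Proof.
move=> /seqcont_within_continuous/subspace_continuousP cf Sp B Bp.
have := cf p (nbhs_singleton Sp) B Bp; rewrite /nbhs/= /within/= => H.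
by apply: filterS2 H Sp => q H Sq; exact: H.
Qed.

Lemma seqcontS (T : topologicalType) (S S' : set T) (f : T -> R) :
  S' `<=` S -> seqcont S f -> seqcont S' f.
Proof. by move=> SS cf x p xS pS xp; apply: cf => // [k|]; exact: SS. Qed.

Lemma seqcontD (T : topologicalType) (S : set T) (f g : T -> R) :
  seqcont S f -> seqcont S g -> seqcont S (fun p => f p + g p).
Proof. by move=> cf cg x p xS pS xp; apply: cvgD; [exact: cf|exact: cg]. Qed.

Lemma seqcontB (T : topologicalType) (S : set T) (f g : T -> R) :
  seqcont S f -> seqcont S g -> seqcont S (fun p => f p - g p).
Proof. by move=> cf cg x p xS pS xp; apply: cvgB; [exact: cf|exact: cg]. Qed.

Lemma seqcontM (T : topologicalType) (S : set T) (f g : T -> R) :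
  seqcont S f -> seqcont S g -> seqcont S (fun p => f p * g p).
Proof. by move=> cf cg x p xS pS xp; apply: cvgM; [exact: cf|exact: cg]. Qed.

Lemma seqcont_near (T : topologicalType) (S : set T) (f : T -> R)
    (x : nat -> T) p : seqcont S f ->
  (\forall k \near \oo, S (x k)) -> S p -> x @ \oo --> p ->
  f (x k) @[k --> \oo] --> f p.
Proof.
move=> cf Sx Sp xp; pose y k := if `[< S (x k) >] then x k else p.
have yx : \forall k \near \oo, y k = x k.
  by apply: filterS Sx => k Sk; rewrite /y asboolT.
have yS k : S (y k) by rewrite /y; case: asboolP.
have yp : y @ \oo --> p.
  by apply: cvg_trans xp; apply: near_eq_cvg; apply: filterS yx => k ->.
apply: cvg_trans (cf y p yS Sp yp); apply: near_eq_cvg.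
by apply: filterS yx => k ->.
Qed.

Lemma cvg_seq_ub (u : nat -> R) (l : R) : u @ \oo --> l ->
  exists T, l <= T /\ forall k, u k <= T.
Proof.
move=> ul; have /cvg_seq_bounded/pinfty_ex_gt0[M M0 uM] : cvgn u.
  by apply/cvg_ex; exists l.
exists (Num.max l M); split; first by rewrite le_max lexx.
by move=> k; rewrite le_max (le_trans (ler_norm _) (uM k I)) orbT.
Qed.

(** Stated along a map h because the measurable structure of T and the topology
    of X may live on different carriers: h is either a slice such as
    z |-> (x + z, t), or the identity from a product sigma-algebra to a product
    topology. *)
Lemma measurable_within_continuous d (T : measurableType d)
    (X : topologicalType) (h : T -> X) (S : set X) (f : X -> R) :
    (forall O, open O -> measurable (h @^-1` O)) ->
    measurable (h @^-1` S) -> {within S, continuous f} ->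
  measurable_fun (h @^-1` S) (f \o h).
Proof.
move=> hop mS /subspace_continuousP cf.
apply: (measurability _ (RGenOInfty.measurableE R)) => // _ [_ [a ->] <-].
pose U := [set y | S y -> `]a, +oo[%classic (f y)]°.
rewrite (_ : _ `&` _ = h @^-1` S `&` h @^-1` U).
  by apply: measurableI => //; apply/hop; exact: open_interior.
apply/seteqP; split => z /= [Sz Uz]; split => //.
  apply: (cf _ Sz `]a, +oo[%classic); apply: open_nbhs_nbhs; split => //.
exact: (interior_subset Uz).
Qed.

(** An open set of the product is a countable union of rational boxes, which are
    measurable rectangles. *)
Lemma open_prod_measurable n (A : set ('rV[R]_n * R)) : open A ->
  measurable (A : set ('rV[R]_n * measurableTypeR R)).
Proof.
move=> oA.
pose box (p : ('rV[rat]_n * 'rV[rat]_n) * (rat * rat)) :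
  set ('rV[R]_n * measurableTypeR R) :=
  (boxo (map_mx ratr p.1.1) (map_mx ratr p.1.2) : set 'rV[R]_n) `*`
  `](ratr p.2.1 : R), ratr p.2.2[%classic.
rewrite (_ : A = \bigcup_(p in [set p | box p `<=` A]) box p); last first.
  apply/seteqP; split => [[x t] Axt|v [p /= pA]]; last exact: pA.
  have /= [[U W] /= [Ux Wt] UWA] : nbhs (x, t) A by exact: open_nbhs_nbhs.
  have := @open_rV_bigcup_box R n U° (@open_interior _ U).
  move=> /seteqP[/(_ x) + _].
  have Ux' : U° x by [].
  move=> /(_ Ux')[[q r] /= qrU xqr].
  have [e /= e0 tW] := iffLR (nbhs_ballP _ _) Wt.
  have /rat_in_itvoo[a] : t - e < t by rewrite ltrBlDr ltrDl.
  have /rat_in_itvoo[b] : t < t + e by rewrite ltrDl.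
  rewrite !in_itv/= => /andP[b1 b2] /andP[a1 a2].
  exists ((q, r), (a, b)) => /=.
    move=> [y s] [/= yqr]; rewrite in_itv/= => /andP[s1 s2]; apply: UWA; split => /=.
      apply: interior_subset; apply: qrU => i; have := yqr i; by rewrite !mxE.
    apply: tW; rewrite /ball/= ltr_distlC.
    by rewrite (lt_trans a1)//= (lt_trans s2).
  split => /=; last by rewrite in_itv/= a2 b1.
  by move=> i; rewrite !mxE; exact: xqr.
rewrite bigcup_mkcond; apply: countable_bigcupT_measurable => [|p].
  exact: countableP.
case: ifPn => // _; apply: measurableX; last exact: measurable_itv.
by apply: open_measurable_rV; exact: open_boxo.
Qed.

Lemma Rdominated_convergence d (T : measurableType d)
    (mu : {measure set T -> \bar R}) (f_ : nat -> T -> R) (f g : T -> R) :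
    (forall k, measurable_fun setT (f_ k)) -> measurable_fun setT f ->
    {ae mu, forall z, f_ k z @[k --> \oo] --> f z} ->
    (forall k z, `|f_ k z| <= g z) -> mu.-integrable setT (EFin \o g) ->
  \int[mu]_z f_ k z @[k --> \oo] --> \int[mu]_z f z.
Proof.
move=> mf_ mf ff fg ig.
have ff' : {ae mu, forall z, setT z ->
    (EFin \o f_ k) z @[k --> \oo] --> (EFin \o f) z}.
  by apply: filterS ff => z H _; apply: cvg_EFin => //; exact: nearW.
have fg' : {ae mu, forall z k, setT z -> (`|(EFin \o f_ k) z| <= (EFin \o g) z)%E}.
  by apply: aeW => z k _; rewrite lee_fin.
have mf_' k : measurable_fun setT (EFin \o f_ k) by exact/measurable_EFinP.
have mf' : measurable_fun setT (EFin \o f) by exact/measurable_EFinP.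
have [i1 _ i3] := dominated_convergence measurableT mf_' mf' ff' ig fg'.
have fi := integrable_fin_num measurableT i1.
by move: i3; rewrite -(fineK fi) => /fine_cvgP[_].
Qed.

Lemma integrable_scale d (T : measurableType d)
    (m : {measure set T -> \bar R}) (D : set T) (k : R) (f : T -> R) :
  measurable D -> m.-integrable D (EFin \o f) ->
  m.-integrable D (EFin \o (fun z => k * f z)).
Proof.
move=> mD fi; rewrite (_ : _ \o _ = fun z => (k%:E * (EFin \o f) z)%E).
  exact: integrableZl.
by apply/funext => z; rewrite /= EFinM.
Qed.

Lemma integrable_cst_finite d (T : measurableType d)
    (m : {measure set T -> \bar R}) (D : set T) (c : R) :
  measurable D -> (m D < +oo)%E -> m.-integrable D (EFin \o cst c).
Proof.
move=> mD Doo; apply/integrableP; split.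
  by apply/measurable_EFinP; exact: measurable_cst.
under eq_integral do rewrite /=.
by rewrite integral_cst// lte_mul_pinfty.
Qed.

(** If the integral vanished, f would vanish almost everywhere, in particular
    somewhere on E. *)
Lemma Rintegral_gt0 d (T : measurableType d) (m : {measure set T -> \bar R})
    (D E : set T) (f : T -> R) :
  measurable D -> measurable E -> E `<=` D -> m E != 0%E ->
  m.-integrable D (EFin \o f) ->
  (forall x, D x -> 0 <= f x) -> (forall x, E x -> 0 < f x) ->
  0 < \int[m]_(x in D) f x.
Proof.
move=> mD mE ED mE0 fi f0 fE.
rewrite lt_neqAle Rintegral_ge0// andbT; apply/eqP => I0.
have mf := measurable_int m fi.
have If : (\int[m]_(x in D) `|(EFin \o f) x| = 0)%E.
  rewrite (eq_integral (fun x => (f x)%:E)); last first.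
    by move=> x /set_mem Dx; rewrite /= ger0_norm// f0.
  by rewrite -(fineK (integrable_fin_num mD fi)) -[fine _]/(\int[m]_(x in D) f x) -I0.
have [N [mN N0 fN]] := iffLR (ae_eq_integral_abs m mD mf) If.
move/eqP : mE0; apply; apply/negligibleP => //; exists N; split => //.
move=> x Ex; apply: fN => /= /(_ (ED _ Ex))[] fx0.
by have := fE x Ex; rewrite fx0 ltxx.
Qed.

End sequential_continuity.

(** * The boundary of a regular domain is negligible *)

Section null_sets.
Context {R : realType}.

(** Countably many rational boxes form a base of the topology, so those that meet
    A in a null set are enough to cover A. *)
Lemma locally_negligible n (m : {measure set 'rV[R]_n -> \bar R}) A :
  (forall p, A p -> exists U, [/\ open U, U p & m.-negligible (A `&` U)]) ->
  m.-negligible A.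
Proof.
move=> locA.
pose box (p : 'rV[rat]_n * 'rV[rat]_n) : set 'rV[R]_n :=
  boxo (map_mx ratr p.1) (map_mx ratr p.2).
pose F k := if unpickle k is Some p then
  if `[< m.-negligible (A `&` box p) >] then A `&` box p else set0 else set0.
apply: (@negligibleS _ _ _ _ (\bigcup_k F k)); last first.
  apply: negligible_bigcup => k; rewrite /F.
  case: unpickle => [p|]; last exact: negligible_set0.
  by case: asboolP => // _; exact: negligible_set0.
move=> p Ap; have [U [oU Up nU]] := locA p Ap.
have /seteqP[/(_ p Up)[[q r] /= qrU pqr] _] := open_rV_bigcup_box oU.
exists (pickle (q, r)) => //; rewrite /F pickleK.
have bU : box (q, r) `<=` U.
  by move=> y yqr; apply: qrU => i; have := yqr i; rewrite !mxE.
case: asboolP => [_|[]].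
  by split => // i; rewrite !mxE; exact: pqr.
by apply: negligibleS nU; exact: setIS.
Qed.

(** All the translates have the measure of E, and N of them fit disjointly
    in B for every N. *)
Lemma disjoint_translates_null n (E B : set 'rV[R]_n) (v : nat -> 'rV[R]_n) :
    measurable E -> measurable B -> (lebesgue_rV n B < +oo)%E ->
    (forall k x, E x -> B (x + v k)) ->
    (forall j k x y, E x -> E y -> x + v j = y + v k -> j = k) ->
  lebesgue_rV n E = 0%E.
Proof.
move=> mE mB Boo EB Ev.
have mEk k : measurable ((fun x => x + - v k) @^-1` E).
  by rewrite -[X in measurable X]setTI; exact: measurable_shift_rV.
have EBs : lebesgue_rV n E = lebesgue_rV n ((fun x => x + - v 0%N) @^-1` E).
  by rewrite lebesgue_rV_shift.
have EleB : (lebesgue_rV n E <= lebesgue_rV n B)%E.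
  rewrite EBs; apply: le_measure; rewrite ?inE// => x /= /(EB 0%N).
  by rewrite subrK.
have Efin : lebesgue_rV n E \is a fin_num.
  by rewrite ge0_fin_numE//; exact: le_lt_trans Boo.
apply/eqP; rewrite eq_le measure_ge0 andbT leNgt; apply/negP => E0.
pose e := fine (lebesgue_rV n E); pose b := fine (lebesgue_rV n B).
have e0 : 0 < e by rewrite fine_gt0// E0/= -ge0_fin_numE.
have Ne N : e *+ N <= b.
  rewrite -lee_fin /b fineK ?ge0_fin_numE//.
  have := @measure_bigsetU_ord _ _ _ (lebesgue_rV n) N xpredT
    (fun k => (fun x => x + - v k) @^-1` E) (fun k => mEk k).
  rewrite (eq_bigr (fun=> e%:E)); last first.
    by move=> i _; rewrite /e fineK//; exact: lebesgue_rV_shift.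
  rewrite sumEFin sumr_const card_ord => <-; last first.
    move=> i j _ _ [x [/= Ei Ej]]; apply: val_inj => /=.
    by apply: (Ev i j _ _ Ei Ej); rewrite !subrK.
  apply: le_measure; rewrite ?inE//; first exact: bigsetU_measurable.
  elim/big_ind : _ => //[A C AB CB x [/AB|/CB]//|i _ x /= /(EB i)].
  by rewrite subrK.
have := Ne (Num.truncn (b / e)).+1; apply/negP; rewrite -ltNge -mulr_natl.
by rewrite -ltr_pdivrMr// truncnS_gt.
Qed.

Lemma is_derive_line (V : normedModType R) (g : V -> R) v b r :
  derivable g (r *: v + b) v ->
  is_derive r 1 (fun s => g (s *: v + b)) ('D_v g (r *: v + b)).
Proof.
have H h : h^-1 *: (((fun s => g (s *: v + b)) \o shift r) (h *: 1) - g (r *: v + b)) =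
  h^-1 *: ((g \o shift (r *: v + b)) (h *: v) - g (r *: v + b)).
  by rewrite /= /shift [h *: 1]mulr1 scalerDl addrA.
move=> dg; apply: DeriveDef.
  by rewrite /derivable; under eq_fun do rewrite H; exact: dg.
by rewrite /derive; under eq_fun do rewrite H.
Qed.

(** Near a boundary point the boundary lies in the zero set of g. Two of its
    points cannot differ by a small multiple of v, by Rolle's theorem on the
    segment that joins them, so its translates by multiples of v are
    disjoint. *)
Lemma smooth_boundary_negligible n (Omega : set 'rV[R]_n) :
  open Omega -> smooth_boundary Omega ->
  (lebesgue_rV n).-negligible (boundary Omega).
Proof.
move=> oO sO; apply: locally_negligible => p bp.
have [U [g [oU Up gU [v Dv] UO]]] := sO p bp.
have [] := gU [:: v] p Up; rewrite /iter_derive/= => cDv _.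
have : \forall x \near p, U x /\ 'D_v g x != 0.
  have Dn : \forall x \near p, 'D_v g x != 0.
    apply: (cDv [set y : R | y != 0]); apply: open_nbhs_nbhs.
    by split => //; exact: open_neq.
  have Un : \forall x \near p, U x by exact: open_nbhs_nbhs.
  by apply: filterS2 Un Dn.
move=> /nbhs_ballP[e /= e0 peU].
pose c := \row_(i < n) e : 'rV[R]_n.
pose bx r := boxo (p - r *: c) (p + r *: c).
have bxe : bx 1 `<=` ball p e.
  move=> x xb; split => // i j; rewrite ord1 /ball/= ltr_distlC.
  by have := xb j; rewrite scale1r !mxE.
have bx2 : bx 2^-1 p.
  move=> i; rewrite !mxE; apply/andP; split; have : 0 < 2^-1 * e by lra.
    lra.
  lra.
exists (bx 2^-1); split => //; first exact: open_boxo.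
pose E := boundary Omega `&` bx 2^-1.
have mE : measurable E.
  apply: measurableI; last by apply: open_measurable_rV; exact: open_boxo.
  apply: measurableD.
    by apply: closed_measurable_rV; exact: closed_closure.
  by apply: open_measurable_rV; exact: open_interior.
apply/negligibleP => //.
have bx21 : bx 2^-1 `<=` bx 1.
  move=> x xb i; have := xb i; rewrite !mxE; lra.
have Eg x : E x -> g x = 0.
  move=> [[clx nx] /bx21/bxe xp]; have [Ux _] := peU x xp.
  have {}nx : ~ Omega x by have <- : interior Omega = Omega by apply/interior_id.
  apply/eqP; rewrite eq_le; apply/andP; split; rewrite leNgt; apply/negP => gx.
    have [cg _] := gU [::] x Ux.
    have gn : \forall y \near x, 0 < g y.
      by apply: (cg [set y : R | 0 < y]); apply: open_nbhs_nbhs; split.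
    have Un : \forall y \near x, U y by exact: open_nbhs_nbhs.
    have [y [Oy [gy Uy]]] := clx _ (filterI gn Un).
    have := iffLR (UO y Uy) Oy; rewrite ltNge => /negP; apply; exact: ltW gy.
  by apply: nx; apply/(UO x Ux).
have v0 : v != 0.
  by apply/eqP => v0; move: Dv; rewrite v0 derive0 eqxx.
have nv0 : 0 < `|v| by rewrite normr_gt0.
(* A shift by less than d along v moves each coordinate by less than e / 2, so
   it does not leave the larger box. *)
pose d := e / 2 / `|v|.
have d0 : 0 < d by rewrite !divr_gt0.
apply: (@disjoint_translates_null n E (bx 1) (fun k => (d / k.+2%:R) *: v)) => //.
- by apply: open_measurable_rV; exact: open_boxo.
- by rewrite lebesgue_rV_box ?ltry// => i; rewrite !mxE; lra.
- move=> k x [_ Ex] i; have := Ex i; rewrite !mxE.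
  have : `|d / k.+2%:R * v 0 i| < 2^-1 * e.
    rewrite normrM gtr0_norm ?divr_gt0//.
    apply: le_lt_trans (ler_wpM2l (ltW (divr_gt0 d0 _)) (ler_coord_norm v i)) _ => //.
    rewrite /d mulrAC divfK ?gt_eqF// ltr_pdivrMr// [ltLHS]mulrC.
    by rewrite ltr_pMr ?mulr_gt0// ltr1n.
  by rewrite ltr_norml; move: (_ * v 0 i) => w; lra.
have key j k x y : E x -> E y -> x + (d / j.+2%:R) *: v = y + (d / k.+2%:R) *: v ->
    ~ (k < j)%N.
  move=> Ex Ey xy kj; pose h := d / k.+2%:R - d / j.+2%:R.
  have h0 : 0 < h by rewrite subr_gt0 ltr_pM2l// ltf_pV2 ?posrE// ltr_nat.
  have xE : x = h *: v + y.
    by rewrite scalerBl addrAC [_ + y]addrC -xy addrK.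
  have yr (r : R) : 0 <= r <= h -> ball p e (r *: v + y).
    move=> /andP[r0 rh]; apply: bxe => i.
    have := Ey.2 i; have := Ex.2 i; rewrite xE !mxE.
    have [v_ge0|v_le0] := leP 0 (v 0 i).
      have := ler_wpM2r v_ge0 rh; have := mulr_ge0 r0 v_ge0; lra.
    have := ler_wnM2r (ltW v_le0) rh; have := mulr_ge0_le0 r0 (ltW v_le0); lra.
  have dr (r : R) : 0 <= r <= h -> is_derive r 1 (fun s : R => g (s *: v + y)) ('D_v g (r *: v + y)).
    move=> /yr/peU[Ur _]; apply: is_derive_line.
    exact: (gU [::] _ Ur).2.
  have dG (r : R) : r \in `]0, h[ -> derivable (fun s : R => g (s *: v + y)) r 1.
    rewrite in_itv/= => /andP[/ltW r0 /ltW rh].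
    by have [] := dr r _; rewrite ?r0.
  have cG : {within `[0, h], continuous (fun s : R => g (s *: v + y))}.
    apply: derivable_within_continuous => r; rewrite in_itv/= => rh.
    by have [] := dr r rh.
  have G0h : g (0 *: v + y) = g (h *: v + y) by rewrite scale0r add0r -xE !Eg.
  have [r + dr0] := Rolle h0 dG cG G0h.
  rewrite in_itv/= => /andP[/ltW r0 /ltW rh].
  have rh' : 0 <= r <= h by rewrite r0.
  have [_ /negP] := peU _ (yr r rh'); apply; apply/eqP.
  have [_ <-] := dr r rh'; exact: derive_val.
move=> j k x y Ex Ey xy.
case: (ltngtP j k) => // jk; exfalso.
  exact: (key _ _ _ _ Ey Ex (esym xy) jk).
exact: (key _ _ _ _ Ex Ey xy jk).
Qed.

End null_sets.

(** * Averages against the density *)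

Section density.
Context {R : realType} {n : nat}.
Local Notation Rn := 'rV[R]_n.
Local Notation lam := (lebesgue_rV n).
Implicit Types (mu : Rn -> R) (S A : set Rn) (f w : Rn * R -> R).

(** Each point outside the support has a neighbourhood of zero mass, on which the
    density vanishes almost everywhere. *)
Lemma density_supp_negligible mu : is_density mu ->
  lam.-negligible [set z : Rn | mu z != 0 /\ ~ supp mu z].
Proof.
move=> [imu mu0 _]; apply: locally_negligible => p [_ /existsNP[U /not_implyP[oU /not_implyP[Up /negP]]]].
rewrite -leNgt => U0; exists U; split => //.
have mU := open_measurable_rV oU.
have mmu : measurable_fun U (EFin \o mu).
  by apply: measurable_funTS; exact: (measurable_int lam imu).
have : (\int[lam]_(x in U) `|(EFin \o mu) x| = 0)%E.
  apply/eqP; rewrite eq_le integral_ge0// andbT.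
  by under eq_integral do rewrite /= ger0_norm//.
move=> /(ae_eq_integral_abs lam mU mmu).
apply: negligibleS => z [[/eqP muz _] Uz] /= /(_ Uz) [].
exact: muz.
Qed.

Lemma measurable_addl_preimage S (x : Rn) :
  measurable S -> measurable [set z | S (x + z)].
Proof.
move=> mS; have := measurable_shift_rV x measurableT mS; rewrite setTI.
by congr measurable; apply/seteqP; split => z /=; rewrite addrC.
Qed.

Lemma negligible_addl_preimage S (x : Rn) :
  lam.-negligible S -> lam.-negligible [set z | S (x + z)].
Proof.
move=> [N [mN N0 SN]]; exists [set z | N (x + z)]; split.
- exact: measurable_addl_preimage.
- rewrite -N0 -(lebesgue_rV_shift x mN); congr (lam _).
  by apply/seteqP; split => z /=; rewrite addrC.
- by move=> z /SN.
Qed.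

Definition cyl S : set (Rn * R) := S `*` `[0, +oo[.

(** Bounded on S over each bounded time interval: what survives the factor e^t,
    and enough for dominated convergence. *)
Definition tbounded S f :=
  forall T, exists B, forall x t, S x -> 0 <= t <= T -> `|f (x, t)| <= B.

(** The two integrals of the nonlocal operator are instances of this one, with S
    the domain or the extended frontier. *)
Definition avg mu S f (p : Rn * R) : R :=
  \int[lam]_(z in [set z | S (p.1 + z)]) (f (p.1 + z, p.2) * mu z).

Definition prim f (p : Rn * R) : R :=
  \int[lebesgue_measure]_(s in `[0, p.2]) f (p.1, s).

Lemma continuous_addl_pair (x : Rn) (t : R) :
  continuous (fun z : Rn => (x + z, t)).
Proof.
move=> z; have c1 : x + y @[y --> z] --> x + z.
  exact: (cvgD (@cvg_cst _ x _ (nbhs z) _) (@cvg_id _ (nbhs z))).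
exact: (cvg_pair c1 (@cvg_cst _ t _ (nbhs z) _)).
Qed.

Lemma measurable_avg_fun S f (x : Rn) (t : R) : measurable S -> 0 <= t ->
  seqcont (cyl S) f ->
  measurable_fun [set z | S (x + z)] (fun z => f (x + z, t)).
Proof.
move=> mS t0 cf.
have E : (fun z : Rn => (x + z, t)) @^-1` (cyl S) = [set z | S (x + z)].
  by apply/seteqP; split => z /= => [[]//|Sz]; split => //=; rewrite in_itv/= t0.
rewrite -E; apply: measurable_within_continuous.
- move=> O oO; apply: open_measurable_rV; apply: open_comp => // z _.
  exact: continuous_addl_pair.
- by rewrite E; exact: measurable_addl_preimage.
- exact: seqcont_within_continuous.
Qed.

Lemma integrable_avg mu S f (x : Rn) (t B : R) : is_density mu ->
  measurable S -> 0 <= t -> seqcont (cyl S) f ->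
  (forall x, S x -> `|f (x, t)| <= B) ->
  lam.-integrable [set z | S (x + z)] (EFin \o (fun z => f (x + z, t) * mu z)).
Proof.
move=> [imu mu0 _] mS t0 cf fB.
have mSx := measurable_addl_preimage x mS.
have iBmu : lam.-integrable [set z | S (x + z)] (EFin \o (fun z => B * mu z)).
  by apply: integrable_scale => //; exact: integrableS imu.
apply: le_integrable iBmu => //.
  apply/measurable_EFinP; apply: measurable_funM; first exact: measurable_avg_fun.
  by apply: measurable_funTS; apply/measurable_EFinP; exact: (measurable_int lam imu).
move=> z /= Sz; rewrite lee_fin !normrM ler_wpM2r//.
exact: le_trans (fB _ Sz) (ler_norm _).
Qed.

Lemma avg_bound mu S f (x : Rn) (t B : R) : is_density mu ->
  measurable S -> 0 <= t -> seqcont (cyl S) f ->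
  (forall x, S x -> `|f (x, t)| <= B) ->
  `|avg mu S f (x, t)| <= B * \int[lam]_(z in [set z | S (x + z)]) mu z.
Proof.
move=> dmu mS t0 cf fB; have iF := integrable_avg x dmu mS t0 cf fB.
have [imu mu0 _] := dmu.
have mSx := measurable_addl_preimage x mS.
have iB : lam.-integrable [set z | S (x + z)] (EFin \o mu) by exact: integrableS imu.
apply: le_trans (le_normr_Rintegral mSx iF) _; rewrite -RintegralZl//.
apply: le_Rintegral => //.
- exact: (integrable_norm iF).
- exact: integrable_scale.
- by move=> z Sz; rewrite normrM (ger0_norm (mu0 z)) ler_wpM2r// fB.
Qed.

(** Dominated convergence: a multiple of mu dominates, and the integrand
    converges at every z for which x0 + z is not on the edge of S as seen from
    the points of A. *)
Lemma seqcont_avg mu S A f : is_density mu -> measurable S ->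
  seqcont (cyl S) f -> tbounded S f ->
  (forall (x : nat -> Rn) x0, (forall k, A (x k)) -> A x0 -> x @ \oo --> x0 ->
    {ae lam, forall z, mu z != 0 -> (S (x0 + z) -> \forall k \near \oo, S (x k + z)) /\
                      (~ S (x0 + z) -> \forall k \near \oo, ~ S (x k + z))}) ->
  seqcont (cyl A) (avg mu S f).
Proof.
move=> dmu mS cf bf aS p [x0 t0] Ap [/= Ax0 ]; rewrite in_itv/= andbT => t00 pxt.
have p1 : (p k).1 @[k --> \oo] --> x0 by exact: (cvg_comp _ _ pxt cvg_fst).
have p2 : (p k).2 @[k --> \oo] --> t0 by exact: (cvg_comp _ _ pxt cvg_snd).
have p20 k : 0 <= (p k).2 by have [_] := Ap k; rewrite /= in_itv/= andbT.
have [T [t0T pT]] := cvg_seq_ub p2.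
have [B fB] := bf T.
have fB0 x : S x -> `|f (x, t0)| <= B by move=> Sx; apply: fB => //; rewrite t00.
have fBk k x : S x -> `|f (x, (p k).2)| <= B by move=> Sx; apply: fB => //; rewrite p20 pT.
pose F (q : Rn * R) := (fun z => f (q.1 + z, q.2) * mu z) \_ [set z | S (q.1 + z)].
rewrite /avg Rintegral_mkcond -/(F (x0, t0)).
under eq_fun do rewrite Rintegral_mkcond.
have [imu mu0 _] := dmu.
have mF q : (0 <= q.2) -> (forall x, S x -> `|f (x, q.2)| <= B) -> measurable_fun setT (F q).
  move=> q0 qB; apply/(measurable_restrictT _ _).1; first exact: measurable_addl_preimage.
  by apply/measurable_EFinP; apply: (measurable_int lam (integrable_avg q.1 dmu mS q0 cf qB)).
apply: (@Rdominated_convergence R _ _ lam (fun k => F (p k)) (F (x0, t0)) (fun z => `|B| * mu z)).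
- by move=> k; apply: mF; [exact: p20|exact: fBk].
- exact: mF.
- have := aS (fun k => (p k).1) x0 (fun k => (Ap k).1) Ax0 p1.
  apply: filterS => z; have [muz _|muz /(_ erefl) [Sy Sn]] := eqVneq (mu z) 0.
    have Fz q : F q z = 0 by rewrite /F patchE muz mulr0; case: ifP.
    by apply: cvg_near_cst; apply: nearW => k; rewrite !Fz.
  have [Sz|Sz] := pselect (S (x0 + z)).
    rewrite /F [in X in _ --> X]patchE mem_set//=.
    apply: (@cvg_trans _ (f ((p k).1 + z, (p k).2) * mu z @[k --> \oo])).
      apply: near_eq_cvg; have := Sy Sz; apply: filterS => k Sk.
      by rewrite /F patchE mem_set.
    apply: cvgMl; apply: (seqcont_near cf (x := fun k => ((p k).1 + z, (p k).2))).
    - have := Sy Sz; apply: filterS => k Sk; split => //=.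
      by rewrite in_itv/= p20.
    - by split => //=; rewrite in_itv/= t00.
    - have p1z : (p k).1 + z @[k --> \oo] --> x0 + z.
        exact: (cvgD p1 (@cvg_cst _ z _ \oo _)).
      exact: (cvg_pair p1z p2).
  rewrite /F [in X in _ --> X]patchE memNset//=.
  apply: cvg_near_cst; have := Sn Sz; apply: filterS => k Sk.
  by rewrite /F patchE memNset.
- move=> k z; rewrite /F patchE; case: ifPn => [/set_mem /= Sz|_]; last by rewrite normr0 mulr_ge0.
  by rewrite normrM (ger0_norm (mu0 z)) ler_wpM2r//; exact: le_trans (fBk _ _ Sz) (ler_norm _).
- exact: integrable_scale.
Qed.
End density.

(** * Primitives in time *)

Section time_primitive.
Context {R : realType} {n : nat}.
Local Notation Rn := 'rV[R]_n.
Implicit Types (A : set Rn) (f w : Rn * R -> R).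

Lemma seqcont_slice A w x : A x -> seqcont (cyl A) w ->
  seqcont (`[0, +oo[%classic : set R) (fun s => w (x, s)).
Proof.
move=> Ax cw u t u0 t0 ut; apply: (cw (fun k => (x, u k))).
- by move=> k; split; [exact: Ax|exact: u0].
- by split.
- exact: (cvg_pair (@cvg_cst _ x _ \oo _) ut).
Qed.

Lemma seqcont_pos_continuous (g : R -> R) (t : R) :
  seqcont (`[0, +oo[%classic : set R) g -> 0 < t -> {for t, continuous g}.
Proof.
move=> cg t0; apply: (seqcont_nbhs cg).
have : \forall s \near t, 0 < s by exact: lt_nbhsr.
by apply: filterS => s s0; rewrite /= in_itv/= ltW.
Qed.

Lemma seqcont_itv_continuous (g : R -> R) (T : R) :
  seqcont (`[0, +oo[%classic : set R) g -> {within `[0, T], continuous g}.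
Proof.
move=> cg; apply: seqcont_within_continuous => u t u0 t0; apply: cg.
- by move=> k; have := u0 k; rewrite /= !in_itv/= => /andP[->].
- by move: t0; rewrite /= !in_itv/= => /andP[->].
Qed.

Lemma integrable_itv (g : R -> R) (T : R) : seqcont (`[0, +oo[%classic : set R) g ->
  lebesgue_measure.-integrable `[0, T] (EFin \o g).
Proof.
move=> cg; apply: continuous_compact_integrable; first exact: segment_compact.
exact: seqcont_itv_continuous.
Qed.

Lemma is_derive_prim A w (x : Rn) (t : R) : A x -> seqcont (cyl A) w -> 0 < t ->
  is_derive t 1 (fun s : R => prim w (x, s)) (w (x, t)).
Proof.
move=> Ax cw t0; have cg := seqcont_slice Ax cw.
have t1 : t < t + 1 by rewrite ltrDl.
have [d1 d2] := continuous_FTC1_closed t1 (integrable_itv (t + 1) cg) t0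
  (seqcont_pos_continuous cg t0).
apply: DeriveDef; first exact: d1.
by rewrite -d2 derive1E.
Qed.

Lemma prim0 w (x : Rn) : prim w (x, 0) = 0.
Proof. by rewrite /prim/= set_itv1 Rintegral_set1. Qed.

(** Dominated convergence again; the integration interval also moves, which
    spoils pointwise convergence only at its limit endpoint. *)
Lemma seqcont_prim A w : seqcont (cyl A) w -> tbounded A w ->
  seqcont (cyl A) (prim w).
Proof.
move=> cw bw p [x0 t0] Ap [/= Ax0 ]; rewrite in_itv/= andbT => t00 pxt.
have p1 : (p k).1 @[k --> \oo] --> x0 by exact: (cvg_comp _ _ pxt cvg_fst).
have p2 : (p k).2 @[k --> \oo] --> t0 by exact: (cvg_comp _ _ pxt cvg_snd).
have p20 k : 0 <= (p k).2 by have [_] := Ap k; rewrite /= in_itv/= andbT.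
have pA k : A (p k).1 by have [] := Ap k.
have [T [t0T pT]] := cvg_seq_ub p2.
have [B wB] := bw T.
pose F (q : Rn * R) := (fun s => w (q.1, s)) \_ `[0, q.2].
rewrite /prim Rintegral_mkcond -/(F (x0, t0)).
under eq_fun do rewrite Rintegral_mkcond.
have mF q : A q.1 -> measurable_fun setT (F q).
  move=> Aq; apply/(measurable_restrictT _ _).1; first exact: measurable_itv.
  have iq := integrable_itv q.2 (seqcont_slice Aq cw).
  by apply/measurable_EFinP; exact: (measurable_int lebesgue_measure iq).
apply: (@Rdominated_convergence R _ _ lebesgue_measure (fun k => F (p k))
  (F (x0, t0)) ((cst `|B|) \_ `[0, T])).
- by move=> k; exact: mF.
- exact: mF.
- exists [set t0]; split => //; first exact: lebesgue_measure_set1.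
  move=> s /= nF; apply: contrapT => /eqP st; apply: nF; rewrite /F.
  have [s0|s0] := ltP s 0.
    apply: cvg_near_cst; apply: nearW => k.
    by rewrite !patchE !memNset//= in_itv/= leNgt s0.
  have [st0|st0] := ltP t0 s.
    apply: cvg_near_cst.
    have : \forall k \near \oo, (p k).2 < s.
      by apply: (p2 [set r | r < s]); exact: lt_nbhsl.
    apply: filterS => k ks.
    by rewrite !patchE !memNset//= in_itv/= (leNgt s) ?ks ?st0 andbF.
  have {}st0 : s < t0 by rewrite lt_neqAle st.
  rewrite [in X in _ --> X]patchE mem_set//= ?in_itv/= ?s0 ?ltW//.
  apply: (@cvg_trans _ (w ((p k).1, s) @[k --> \oo])).
    apply: near_eq_cvg.
    have : \forall k \near \oo, s < (p k).2.
      by apply: (p2 [set r | s < r]); exact: lt_nbhsr.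
    by apply: filterS => k ks; rewrite patchE mem_set//= in_itv/= s0 ltW.
  apply: (cw (fun k => ((p k).1, s))).
  + by move=> k; split => //=; rewrite in_itv/= s0.
  + by split => //=; rewrite in_itv/= s0.
  + exact: (cvg_pair p1 (@cvg_cst _ s _ \oo _)).
- move=> k s; rewrite /F !patchE.
  case: ifPn => [|_]; last by rewrite normr0; case: ifP.
  rewrite inE/= in_itv/= => /andP[s0 sk].
  have sT := le_trans sk (pT k).
  rewrite mem_set/= ?in_itv/= ?s0//.
  by apply: le_trans (wB _ _ (pA k) _) (ler_norm _); rewrite s0.
- rewrite -restrict_EFin; apply/integrable_restrict => //; rewrite setTI.
  apply: continuous_compact_integrable; first exact: segment_compact.
  by apply: continuous_subspaceT => z; exact: cvg_cst.
Qed.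

(** Derivability is only asked at positive times, where the solutions of the
    problem have it. *)
Lemma FTC2_nneg (F g : R -> R) (T : R) : 0 < T ->
  seqcont (`[0, +oo[%classic : set R) F -> seqcont (`[0, +oo[%classic : set R) g ->
  (forall t : R, 0 < t -> is_derive t 1 F (g t)) ->
  \int[lebesgue_measure]_(s in `[0, T]) g s = F T - F 0.
Proof.
move=> T0 cF cg dF.
rewrite /Rintegral (@continuous_FTC2 _ _ F)//=.
- exact: seqcont_itv_continuous.
- split.
  + by move=> t; rewrite in_itv/= => /andP[/dF[]].
  + have /seqcont_within_continuous/subspace_continuousP/(_ 0) := cF.
    rewrite /= in_itv/= lexx => /(_ erefl) F0 B B0.
    have := F0 B B0; rewrite /nbhs/= /at_right /within/=.
    by apply: filterS => t Bt t0; apply: Bt; rewrite in_itv/= ltW.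
  + by apply: cvg_at_left_filter; exact: seqcont_pos_continuous.
- move=> t; rewrite in_itv/= => /andP[/dF dt _].
  by rewrite derive1E; apply: derive_val.
Qed.

Lemma is_derive_expRM (c t : R) :
  is_derive t 1 (fun s : R => expR (c * s)) (c * expR (c * t)).
Proof.
have d1 : is_derive t 1 ( *%R c : R -> R) c.
  have := @is_deriveZ R R R id c t 1 1 _; rewrite -[c *: 1]/(c * 1) mulr1.
  by apply.
have := @is_derive1_comp R expR ( *%R c) t _ _ (is_derive_expR (c * t)) d1.
by rewrite mulrC.
Qed.

Lemma continuous_expRM (c : R) : continuous (fun s : R => expR (c * s)).
Proof.
move=> s; apply: differentiable_continuous; apply/derivable1_diffP.
by have [] := is_derive_expRM c s.
Qed.

Lemma integral_expR (c t : R) : 0 < c -> 0 < t ->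
  \int[lebesgue_measure]_(s in `[0, t]) expR (c * s) = (expR (c * t) - 1) / c.
Proof.
move=> c0 t0; pose F (s : R) := c^-1 * expR (c * s).
have -> : \int[lebesgue_measure]_(s in `[0, t]) expR (c * s) = F t - F 0.
  apply: FTC2_nneg => //.
  - apply: continuous_seqcont => s; apply: cvgMr; exact: continuous_expRM.
  - by apply: continuous_seqcont; exact: continuous_expRM.
  - move=> s _.
    rewrite [X in is_derive _ _ _ X](_ : _ = c^-1 *: (c * expR (c * s))).
      by apply: is_deriveZ; exact: is_derive_expRM.
    by rewrite /GRing.scale/= mulKf// gt_eqF.
by rewrite /F mulr0 expR0 -mulrBr mulrC.
Qed.

(** The gain of the factor 1 / c is what makes the integral operators
    contractions in exponentially weighted norms. *)
Lemma prim_bound A w (x : Rn) (t c N : R) : A x -> seqcont (cyl A) w -> 0 < c -> 0 <= t ->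
  (forall s, 0 <= s <= t -> `|w (x, s)| <= N * expR (c * s)) ->
  `|prim w (x, t)| <= N * ((expR (c * t) - 1) / c).
Proof.
move=> Ax cw c0; rewrite le_eqVlt => /predU1P[<- _|t0 wN].
  by rewrite prim0 normr0 mulr0 expR0 subrr mul0r mulr0.
have cg := seqcont_slice Ax cw.
have ie : lebesgue_measure.-integrable `[0, t] (EFin \o (fun s => expR (c * s))).
  by apply: integrable_itv; apply: continuous_seqcont; exact: continuous_expRM.
rewrite /prim; apply: le_trans (le_normr_Rintegral _ (integrable_itv t cg)) _ => //.
rewrite -integral_expR// -RintegralZl//; apply: le_Rintegral => //.
- exact: (integrable_norm (integrable_itv t cg)).
- exact: integrable_scale.
Qed.

End time_primitive.

(** * Smooth compactly supported functions *)

Section flat_functions.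
Context {R : realType}.

(** From y / m <= e^(y / m), raised to the power m. *)
Lemma exprn_le_expR (m : nat) (y : R) : 0 <= y -> y ^+ m <= m%:R ^+ m * expR y.
Proof.
move=> y0; case: m => [|m].
  by rewrite !expr0 mul1r -expR0 ler_expR.
have m0 : 0 < m.+1%:R :> R by rewrite ltr0n.
have : (y / m.+1%:R) ^+ m.+1 <= expR y.
  have -> : expR y = expR (y / m.+1%:R) ^+ m.+1.
    by rewrite -expRM_natl mulrC divfK// gt_eqF.
  apply: lerXn2r; rewrite ?nnegrE ?expR_ge0 ?divr_ge0//.
  by apply: le_trans _ (expR_ge1Dx _); rewrite lerDr.
by rewrite expr_div_n ler_pdivrMr ?exprn_gt0// mulrC.
Qed.

Lemma horner_le_expR (Q : {poly R}) :
  exists C, forall y, 0 <= y -> `|Q.[y]| <= C * expR y.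
Proof.
exists (\sum_(i < size Q) `|Q`_i| * i%:R ^+ i) => y y0.
rewrite horner_coef mulr_suml; apply: le_trans (ler_norm_sum _ _ _) _.
apply: ler_sum => i _; rewrite normrM -mulrA ler_wpM2l// ger0_norm ?exprn_ge0//.
exact: exprn_le_expR.
Qed.

(** For P = 1 this is the classical function e^(-1/s), extended by 0; the
    polynomial factor makes the family stable under derivation. *)
Definition flat (P : {poly R}) (s : R) : R :=
  if 0 < s then P.[s^-1] * expR (- s^-1) else 0.

(** The derivative of P(1/s) e^(-1/s) is Q(1/s) e^(-1/s) for this Q. *)
Definition flat_next (P : {poly R}) : {poly R} := 'X^2 * (P - P^`()).

(** Only s = 0 needs an argument: there the difference quotient is
    y P(y) e^(-y) with y = 1/s, which is at most C / y because y^2 P(y) is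
    dominated by the exponential. *)
Lemma is_derive_flat (P : {poly R}) (s : R) :
  is_derive s 1 (flat P) (flat (flat_next P) s).
Proof.
have [s0|s0|->] := ltgtP s 0.
- rewrite /flat ltNge ltW//=.
  have H : \forall y \near s, cst 0 y = flat P y.
    have : \forall y \near s, y < 0 by exact: lt_nbhsl.
    by apply: filterS => y y0; rewrite /flat ltNge ltW.
  exact: (near_eq_is_derive H (is_derive_cst _ _ _)).
- have H : \forall y \near s, P.[y^-1] * expR (- y^-1) = flat P y.
    have : \forall y \near s, 0 < y by exact: lt_nbhsr.
    by apply: filterS => y y0; rewrite /flat y0.
  apply: (near_eq_is_derive H).
  have dinv : is_derive s 1 (fun y : R => y^-1) (- s^-2).
    have := @is_deriveV R id s 1 1 (lt0r_neq0 s0) (is_derive_id _ _).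
    by rewrite -[(- s ^- 2) *: 1]/(- s ^- 2 * 1) mulr1.
  have dP : is_derive s 1 (fun y : R => P.[y^-1]) (- s^-2 * P^`().[s^-1]).
    have dPs : is_derive s^-1 1 (horner P) P^`().[s^-1].
      by apply: DeriveDef; [exact: derivable_horner|rewrite derivE derive1E].
    by have := @is_derive1_comp R (horner P) (fun y => y^-1) s _ _ dPs dinv; rewrite mulrC.
  have dE : is_derive s 1 (fun y : R => expR (- y^-1)) (s^-2 * expR (- s^-1)).
    have dn : is_derive s 1 (fun y : R => - y^-1) (s^-2).
      by have := is_deriveN dinv; rewrite opprK.
    by have := @is_derive1_comp R expR (fun y => - y^-1) s _ _ (is_derive_expR _) dn; rewrite mulrC.
  have := is_deriveM dP dE.
  rewrite /flat s0 /flat_next !hornerE /GRing.scale/=.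
  by congr (is_derive _ _ _ _); rewrite !exprVn; ring.
- rewrite [X in is_derive _ _ _ X](_ : _ = 0); last by rewrite /flat ltxx.
  have [C HC] := horner_le_expR ('X^2 * P).
  have lim0 : h^-1 *: ((flat P \o shift 0) (h *: 1) - flat P 0) @[h --> 0^'] --> (0 : R).
    apply/cvgrPdist_lt => e e0; near=> h.
    rewrite sub0r normrN /= addr0 [h *: 1]mulr1 {2}/flat ltxx subr0 /flat.
    case: ifPn => h0; last by rewrite scaler0 normr0.
    have hi0 : 0 <= h^-1 by rewrite invr_ge0 ltW.
    have := HC h^-1 hi0; rewrite !hornerE/= normrM (ger0_norm (exprn_ge0 _ hi0)) => HCh.
    rewrite /GRing.scale/= !normrM (ger0_norm hi0) (ger0_norm (expR_ge0 _)).
    rewrite (_ : _ * _ = h * (h^-1 ^+ 2 * `|P.[h^-1]| * expR (- h^-1))); last first.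
      by rewrite expr2 !mulrA divff ?mul1r// gt_eqF.
    apply: (@le_lt_trans _ _ (h * `|C|)).
      apply: ler_wpM2l; first exact: ltW.
      rewrite expRN ler_pdivrMr ?expR_gt0//.
      by apply: le_trans HCh _; rewrite ler_wpM2r ?expR_ge0// ler_norm.
    apply: (@le_lt_trans _ _ (h * (`|C| + 1))); first by rewrite ler_wpM2l ?lerDl// ltW.
    rewrite -ltr_pdivlMr ?ltr_wpDl// -(gtr0_norm h0).
    near: h; apply: dnbhs0_lt; by rewrite divr_gt0// ltr_wpDl.
  apply: DeriveDef; first by apply/cvg_ex; exists 0.
  exact: (cvg_lim _ lim0).
Unshelve. all: by end_near. Qed.

End flat_functions.

Section smooth_algebra.
Context {R : realType}.

(** A class of functions that is visibly stable under directional derivatives,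
    whence smoothness of all orders. A one-variable smooth function enters
    through the sequence F of its successive derivatives, composed with an
    affine map l of linear part lin. *)
Inductive smooth_alg (V : normedModType R) : (V -> R) -> Prop :=
| smooth_alg_cst c : smooth_alg (fun=> c)
| smooth_alg_tower (F : nat -> R -> R) (l lin : V -> R) k :
    (forall k (s : R), is_derive s 1 (F k) (F k.+1 s)) ->
    continuous l ->
    (forall (h : R) v x, l (h *: v + x) = h * lin v + l x) ->
    smooth_alg (fun x => F k (l x))
| smooth_alg_add f g : smooth_alg f -> smooth_alg g -> smooth_alg (fun x => f x + g x)
| smooth_alg_mul f g : smooth_alg f -> smooth_alg g -> smooth_alg (fun x => f x * g x).

Lemma is_derive_comp_affine (V : normedModType R) (F F' : R -> R)
    (l lin : V -> R) (x v : V) :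
  (forall s : R, is_derive s 1 F (F' s)) ->
  (forall (h : R) v x, l (h *: v + x) = h * lin v + l x) ->
  is_derive x v (fun x => F (l x)) (F' (l x) * lin v).
Proof.
move=> dF hl.
have dFl : differentiable F (l x).
  by apply/derivable1_diffP; have [] := dF (l x).
have E : (fun h => h^-1 *: (((fun x => F (l x)) \o shift x) (h *: v) - F (l x))) =
  (fun h => h^-1 *: ((F \o shift (l x)) (h *: lin v) - F (l x))).
  by apply/funext => h; rewrite /= hl.
have dl := diff_derivable (v := lin v) dFl.
apply: DeriveDef; first by rewrite /derivable E; exact: dl.
rewrite /derive E -/(derive F (l x) (lin v)) deriveE//.
have -> : lin v = lin v *: 1 :> R by rewrite /GRing.scale/= mulr1.
rewrite linearZ/= -deriveE// (@derive_val _ _ _ _ _ _ _ (dF (l x))).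
by rewrite /GRing.scale/= mulr1 mulrC.
Qed.

Lemma smooth_alg_is_derive (V : normedModType R) (f : V -> R) (v : V) : smooth_alg f ->
  exists g, smooth_alg g /\ forall x, is_derive x v f (g x).
Proof.
elim=> [c|F l lin k dF cl hl|{}f g Sf [f' [Sf' df]] Sg [g' [Sg' dg]]|
  {}f g Sf [f' [Sf' df]] Sg [g' [Sg' dg]]].
- exists (fun=> 0); split; first exact: smooth_alg_cst.
  by move=> x; exact: is_derive_cst.
- exists (fun x => F k.+1 (l x) * lin v); split.
    by apply: (@smooth_alg_mul _ (fun x => F k.+1 (l x)) (fun=> lin v)); [exact: smooth_alg_tower hl|exact: smooth_alg_cst].
  by move=> x; exact: is_derive_comp_affine.
- exists (fun x => f' x + g' x); split; first exact: smooth_alg_add.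
  by move=> x; exact: is_deriveD.
- exists (fun x => f x * g' x + g x * f' x); split.
    by apply: (@smooth_alg_add _ (fun x => f x * g' x) (fun x => g x * f' x)); exact: smooth_alg_mul.
  by move=> x; exact: is_deriveM.
Qed.

Lemma smooth_alg_continuous (V : normedModType R) (f : V -> R) : smooth_alg f -> continuous f.
Proof.
elim=> [c|F l lin k dF cl hl|{}f g _ cf _ cg|{}f g _ cf _ cg] x.
- exact: cvg_cst.
- apply: (@continuous_comp _ _ _ l (F k)); first exact: cl.
  apply: differentiable_continuous; apply/derivable1_diffP.
  by have [] := dF k (l x).
- exact: cvgD (cf x) (cg x).
- exact: cvgM (cf x) (cg x).
Qed.

Lemma smooth_alg_derive (V : normedModType R) (f : V -> R) (v : V) : smooth_alg f -> smooth_alg ('D_v f).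
Proof.
move=> /(smooth_alg_is_derive v)[g [Sg df]].
have -> // : 'D_v f = g by apply/funext => x; apply: derive_val.
Qed.

Lemma smooth_alg_smooth_on (V : normedModType R) (f : V -> R) : smooth_alg f -> smooth_on setT f.
Proof.
move=> Sf s x _.
have Ss : smooth_alg (iter_derive s f) by elim: s => //= v s; exact: smooth_alg_derive.
split; first exact: smooth_alg_continuous.
by move=> v; have [g [_ /(_ x)[]]] := smooth_alg_is_derive v Ss.
Qed.

(** Turns a one-variable member of the class back into a sequence of derivatives,
    so that it can be composed with affine maps or integrated. *)
Lemma smooth_alg_exists_tower (f : R -> R) : smooth_alg f -> exists F : nat -> R -> R,
  F 0%N = f /\ forall k (s : R), is_derive s 1 (F k) (F k.+1 s).
Proof.
move=> Sf; exists (fun k => iter k (fun g : R -> R => 'D_1 g) f); split => // k s /=.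
have Sk : smooth_alg (iter k (fun g : R -> R => 'D_1 g) f) by elim: k => //= k; exact: smooth_alg_derive.
have [g [_ /(_ s)[dg _]]] := smooth_alg_is_derive (1 : R) Sk.
exact: derivableP.
Qed.

Lemma smooth_alg_comp_affine (V : normedModType R) (f : R -> R) (l lin : V -> R) :
  smooth_alg f -> continuous l ->
  (forall (h : R) v x, l (h *: v + x) = h * lin v + l x) ->
  smooth_alg (fun x => f (l x)).
Proof.
by move=> /smooth_alg_exists_tower[F [<- dF]] cl hl; exact: (smooth_alg_tower 0%N dF cl hl).
Qed.

Lemma smooth_alg_prod (V : normedModType R) (I : Type) (r : seq I) (f : I -> V -> R) :
  (forall i, smooth_alg (f i)) -> smooth_alg (fun x => \prod_(i <- r) f i x).
Proof.
move=> Sf; elim: r => [|i r IH].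
  by rewrite (_ : (fun _ => _) = fun=> 1); [exact: smooth_alg_cst|apply/funext => x; rewrite big_nil].
rewrite (_ : (fun _ => _) = fun x => f i x * \prod_(j <- r) f j x).
  exact: smooth_alg_mul.
by apply/funext => x; rewrite big_cons.
Qed.

Lemma smooth_alg_flat : smooth_alg (flat (1 : {poly R})).
Proof.
have H (k : nat) (s : R) : is_derive s 1 (flat (iter k (@flat_next R) 1)) (flat (iter k.+1 (@flat_next R) 1) s).
  exact: is_derive_flat.
by apply: (smooth_alg_tower (l := id) (lin := id) 0%N H) => // s; exact: cvg_id.
Qed.

(** A smooth bump, positive exactly on ]p, q[. *)
Definition window (p q t : R) := flat 1 (t - p) * flat 1 (q - t).

Lemma smooth_alg_window p q : smooth_alg (window p q).
Proof.
apply: (@smooth_alg_mul _ (fun t => flat 1 (t - p)) (fun t => flat 1 (q - t))).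
- apply: (@smooth_alg_comp_affine _ _ (fun t => t - p) id smooth_alg_flat).
    by move=> t; apply: cvgB; [exact: cvg_id|exact: cvg_cst].
  by move=> h v x; rewrite addrA.
- apply: (@smooth_alg_comp_affine _ _ (fun t => q - t) -%R smooth_alg_flat).
    by move=> t; apply: cvgB; [exact: cvg_cst|exact: cvg_id].
  by move=> h v x; rewrite /GRing.scale/=; ring.
Qed.

Lemma window_gt0 p q t : p < t < q -> 0 < window p q t.
Proof.
move=> /andP[pt tq]; rewrite /window /flat !subr_gt0 pt tq !hornerC !mul1r.
by rewrite mulr_gt0 ?expR_gt0.
Qed.

Lemma window_ge0 p q t : 0 <= window p q t.
Proof.
by rewrite /window /flat !hornerC !mul1r; apply: mulr_ge0; case: ifP => // _; rewrite expR_ge0.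
Qed.

Lemma window_eq0 p q t : ~~ (p < t < q) -> window p q t = 0.
Proof.
rewrite negb_and /window /flat !subr_gt0 => /orP[/negbTE ->|/negbTE ->].
  by rewrite mul0r.
by rewrite mulr0.
Qed.

Lemma bump_primitive (g : R -> R) (p q : R) : continuous g -> 0 < p -> p < q ->
  (forall t, ~~ (p < t < q) -> g t = 0) ->
  \int[lebesgue_measure]_(s in `[0, q]) g s = 0 ->
  exists eta : R -> R, (forall t : R, is_derive t 1 eta (g t)) /\
    (forall t, ~~ (p < t < q) -> eta t = 0).
Proof.
move=> cg p0 pq g0 I0.
pose eta (t : R) := \int[lebesgue_measure]_(s in `[0, t]) g s.
have ig T : lebesgue_measure.-integrable `[0, T] (EFin \o g).
  by apply: integrable_itv; exact: continuous_seqcont.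
have etap t : t <= p -> eta t = 0.
  move=> tp; rewrite /eta (@eq_Rintegral _ _ _ _ _ (cst 0)).
    by rewrite Rintegral_cst// mul0r.
  move=> s; rewrite inE/= in_itv/= => /andP[_ st]; apply: g0.
  by rewrite ltNge (le_trans st tp).
exists eta; split => t.
  have [tp|pt] := ltP t p.
    rewrite g0; last by rewrite ltNge (ltW tp).
    have H : \forall s \near t, cst 0 s = eta s.
      have : \forall s \near t, s < p by exact: lt_nbhsl.
      by apply: filterS => s sp; rewrite etap// ltW.
    exact: (near_eq_is_derive H (is_derive_cst _ _ _)).
  have t0 := lt_le_trans p0 pt.
  have t1 : t < t + 1 by rewrite ltrDl.
  have [d1 d2] := continuous_FTC1_closed t1 (ig (t + 1)) t0 (cg t).
  by apply: DeriveDef; [exact: d1|rewrite -d2 derive1E].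
rewrite negb_and -!leNgt => /orP[|qt]; first exact: etap.
have q0 := lt_trans p0 pq.
have := @Rintegral_itvB R g (BLeft 0) (BRight t) q (ig t).
rewrite !bnd_simp => /(_ (ltW q0) qt).
rewrite I0 subr0 /eta => ->.
rewrite (@eq_Rintegral _ _ _ _ _ (cst 0)); first by rewrite Rintegral_cst// mul0r.
move=> s; rewrite inE/= in_itv/= => /andP[qs _]; apply: g0.
by rewrite (ltNge s) (ltW qs) andbF.
Qed.

Lemma Rintegral_window_gt0 (p q T : R) : 0 < p -> p < q -> q <= T ->
  0 < \int[lebesgue_measure]_(s in `[0, T]) window p q s.
Proof.
move=> p0 pq qT; apply: (@Rintegral_gt0 R _ _ lebesgue_measure _ `]p, q[%classic) => //.
- move=> s /=; rewrite !in_itv/= => /andP[ps sq].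
  by rewrite (ltW (lt_trans p0 ps)) (le_trans (ltW sq) qT).
- apply/eqP => pq0.
  have lpq : lebesgue_measure `]p, q[%classic = (q - p)%:E.
    by rewrite lebesgue_measure_itv/= lte_fin pq EFinB.
  by have [/eqP] := etrans (esym lpq) pq0; rewrite subr_eq0 gt_eqF.
- by apply: integrable_itv; apply: continuous_seqcont; exact: smooth_alg_continuous (smooth_alg_window p q).
- by move=> s _; exact: window_ge0.
- by move=> s /=; rewrite in_itv/=; exact: window_gt0.
Qed.

(** The weights al and be are the integrals of the opposite windows, which makes
    the two humps of the derivative balance, so that the primitive returns to
    zero and has compact support. *)
Lemma exists_time_test (p1 q1 p2 q2 : R) :
    0 < p1 -> p1 < q1 -> q1 <= p2 -> p2 < q2 ->
  exists al be (eta : R -> R), [/\ 0 < al, 0 < be, smooth_alg eta,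
    forall t : R, is_derive t 1 eta (al * window p1 q1 t - be * window p2 q2 t) &
    forall t, ~~ (p1 < t < q2) -> eta t = 0].
Proof.
move=> p10 pq1 qp pq2.
have p20 : 0 < p2 by apply: lt_le_trans qp; exact: lt_trans pq1.
have q12 : q1 <= q2 by apply: le_trans qp _; exact: ltW.
pose I p q := \int[lebesgue_measure]_(s in `[0, q2]) window p q s.
pose g t := I p2 q2 * window p1 q1 t + (- I p1 q1) * window p2 q2 t.
have Sg : smooth_alg g.
  by apply: (@smooth_alg_add _ (fun t => I p2 q2 * window p1 q1 t) (fun t => (- I p1 q1) * window p2 q2 t));
    (apply: (@smooth_alg_mul _ (fun=> _)); [exact: smooth_alg_cst|exact: smooth_alg_window]).
have iwindow p q : lebesgue_measure.-integrable `[0, q2] (EFin \o window p q).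
  by apply: integrable_itv; apply: continuous_seqcont; exact: smooth_alg_continuous (smooth_alg_window p q).
have [|||eta [deta eta0]] := @bump_primitive g p1 q2 (smooth_alg_continuous Sg) p10.
- by apply: lt_le_trans q12.
- move=> t tn; rewrite /g !window_eq0 ?mulr0 ?addr0//.
    apply: contra tn => /andP[pt tq]; rewrite tq andbT.
    by apply: lt_trans pt; apply: lt_le_trans qp.
  by apply: contra tn => /andP[-> tq]; exact: lt_le_trans q12.
- rewrite /g RintegralD//; [|exact: integrable_scale..].
  rewrite (RintegralZl _ _ (iwindow p1 q1))// (RintegralZl _ _ (iwindow p2 q2))//.
  by rewrite mulNr [X in _ - X]mulrC; exact: subrr.
- exists (I p2 q2), (I p1 q1), eta; split => //.
  + exact: Rintegral_window_gt0.
  + exact: Rintegral_window_gt0.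
  + have [G [G0 dG]] := smooth_alg_exists_tower Sg.
    pose F k := if k is k'.+1 then G k' else eta.
    have dF k (s : R) : is_derive s 1 (F k) (F k.+1 s).
      by case: k => [|k] /=; [rewrite G0; exact: deta|exact: dG].
    by apply: (smooth_alg_tower (l := id) (lin := id) 0%N dF) => // s; exact: cvg_id.
  + by move=> t; have := deta t; rewrite /g mulNr.
Qed.

Lemma smooth_alg_box_window n (a b : 'rV[R]_n) (eta : R -> R) : smooth_alg eta ->
  smooth_alg (fun p : 'rV[R]_n * R => \prod_(i < n) window (a 0 i) (b 0 i) (p.1 0 i) * eta p.2).
Proof.
move=> Se; apply: (@smooth_alg_mul _ (fun p : 'rV[R]_n * R => \prod_(i < n) window (a 0 i) (b 0 i) (p.1 0 i))
   (fun p => eta p.2)).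
  apply: (@smooth_alg_prod _ _ _ (fun i (p : 'rV[R]_n * R) => window (a 0 i) (b 0 i) (p.1 0 i))) => i.
  apply: (@smooth_alg_comp_affine _ _ (fun p : 'rV[R]_n * R => p.1 0 i) (fun p => p.1 0 i)).
  - exact: smooth_alg_window.
  - move=> p; apply: (@continuous_comp _ _ _ fst (fun x : 'rV[R]_n => x 0 i)); first exact: cvg_fst.
    exact: coord_continuous.
  - by move=> h v x; rewrite /= !mxE.
apply: (@smooth_alg_comp_affine _ _ (fun p : 'rV[R]_n * R => p.2) (fun p => p.2)) => //.
by move=> p; exact: cvg_snd.
Qed.

Lemma test_function_box_window n (a b : 'rV[R]_n) (eta : R -> R) (p q : R)
    (D : set ('rV[R]_n * R)) :
  smooth_alg eta -> (forall t, ~~ (p < t < q) -> eta t = 0) ->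
  (forall (x : 'rV[R]_n) t, (forall i, a 0 i <= x 0 i <= b 0 i) -> p <= t <= q -> D (x, t)) ->
  test_function D
    (fun p : 'rV[R]_n * R => \prod_(i < n) window (a 0 i) (b 0 i) (p.1 0 i) * eta p.2).
Proof.
move=> Se eta0 KD.
pose K1 := [set x : 'rV[R]_n | forall i, `[a 0 i, b 0 i]%classic (x 0 i)].
pose K : set ('rV[R]_n * R) := K1 `*` `[p, q].
have cK : compact K.
  apply: compact_setX; last exact: segment_compact.
  by apply: (@rV_compact R n (fun i => `[a 0 i, b 0 i]%classic)) => i; exact: segment_compact.
have clK : closed K by apply: compact_closed cK; exact: norm_hausdorff.
set psi := (fun p => _); have sK : closure [set p | psi p != 0] `<=` K.
  have -> : K = closure K by apply/closure_id.
  apply: closureS => -[x t] /=.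
  rewrite mulf_eq0 negb_or => /andP[/prodf_neq0 px et]; split.
    move=> i; have := px i isT; apply: contraNP => /negP xi.
    rewrite /= in_itv/= in xi; rewrite window_eq0//; apply: contra xi.
    by move=> /andP[/ltW -> /ltW ->].
  rewrite /= in_itv/=; apply: contraNT et => tn; apply/eqP/eta0; apply: contra tn.
  by move=> /andP[/ltW -> /ltW ->].
split.
- by apply: smooth_alg_smooth_on; exact: smooth_alg_box_window.
- by apply: subclosed_compact cK sK; exact: closed_closure.
- move=> [x t] /sK[/= K1x]; rewrite in_itv/= => tpq; exact: KD.
Qed.

Lemma is_derive_time n (chi : 'rV[R]_n -> R) (eta : R -> R) (x : 'rV[R]_n) (t d : R) :
  is_derive t 1 eta d ->
  is_derive (x, t) ((0, 1) : 'rV[R]_n * R) (fun p => chi p.1 * eta p.2) (chi x * d).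
Proof.
move=> de; have E : (fun h : R => h^-1 *: (((fun p : 'rV[R]_n * R => chi p.1 * eta p.2) \o shift (x, t))
     (h *: ((0, 1) : 'rV[R]_n * R)) - chi x * eta t)) =
  (fun h => h^-1 *: (((fun s => chi x *: eta s) \o shift t) (h *: 1) - chi x *: eta t)).
  by apply/funext => h; rewrite /= scaler0 add0r.
have dz : is_derive t 1 (fun s => chi x *: eta s) (chi x *: d) by exact: is_deriveZ.
apply: DeriveDef; first by rewrite /derivable E; case: dz.
by rewrite /derive E; case: dz.
Qed.

End smooth_algebra.

(** * From classical to distributional time derivatives *)

Section distributions.
Context {R : realType} {n : nat}.
Local Notation Rn := 'rV[R]_n.
Local Notation lam := (lebesgue_rV n).
Local Notation st := (@space_time R n).
Implicit Types (Omega : set Rn) (f w h k psi : Rn * R -> R).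

Definition ocyl Omega : set (Rn * R) := Omega `*` `]0, +oo[.

Lemma space_time_rect (A : set Rn) (B : set (measurableTypeR R)) :
  measurable A -> measurable B ->
  st (A `*` B) = (lam A * lebesgue_measure B)%E.
Proof. by move=> mA mB; exact: product_measure1E. Qed.

Lemma measurable_ocyl Omega : open Omega ->
  measurable (ocyl Omega : set (Rn * measurableTypeR R)).
Proof.
move=> oO; apply: measurableX; last exact: measurable_itv.
exact: open_measurable_rV.
Qed.

Lemma ocyl_sub Omega p : ocyl Omega p -> cyl Omega p.
Proof. by move=> [Op]; rewrite /= !in_itv/= !andbT => /ltW p0; split => //=; rewrite in_itv/= p0. Qed.

Lemma open_ocyl Omega : open Omega -> open (ocyl Omega).
Proof.
move=> oO; rewrite openE => -[x t] [Ox t0].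
exists (Omega, `]0, +oo[%classic) => //; split.
  exact: open_nbhs_nbhs.
by apply: open_nbhs_nbhs; split => //; exact: itv_open.
Qed.

Lemma measurable_ocyl_fun Omega h : open Omega -> seqcont (cyl Omega) h ->
  measurable_fun (ocyl Omega : set (Rn * measurableTypeR R)) h.
Proof.
move=> oO ch.
have := @measurable_within_continuous R _ (Rn * measurableTypeR R)%type
  (Rn * R)%type id (ocyl Omega) h.
apply; [by move=> O; exact: open_prod_measurable|exact: measurable_ocyl|].
apply: seqcont_within_continuous => x p xO Op xp; apply: ch => //.
  by move=> k'; apply: ocyl_sub.
exact: ocyl_sub.
Qed.

Lemma bounded_set_finite_measure Omega : bounded_set Omega ->
  exists2 E : set Rn, measurable E /\ Omega `<=` E & (lam E < +oo)%E.
Proof.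
move=> /pinfty_ex_gt0[M M0 OM].
pose c := \row_(i < n) (M + 1) : Rn.
exists (boxo (- c) c).
  split; first by apply: open_measurable_rV; exact: open_boxo.
  move=> x /OM xM i; rewrite !mxE.
  have := le_trans (ler_coord_norm x i) xM.
  rewrite ler_norml; lra.
by rewrite lebesgue_rV_box ?ltry// => i; rewrite !mxE; lra.
Qed.

(** The integrand is bounded and vanishes outside a bounded set. The time bound M
    comes from the support of k, so h need only be bounded up to M. *)
Lemma integrable_compact_support Omega h k (K : set (Rn * R)) :
    open Omega -> bounded_set Omega -> seqcont (cyl Omega) h -> tbounded Omega h ->
    continuous k -> compact K -> (forall p, ~ K p -> k p = 0) ->
  st.-integrable (ocyl Omega) (EFin \o (fun p => h p * k p)).
Proof.
move=> oO bO ch bh ck cK k0.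
have [E [mE OE] Eoo] := bounded_set_finite_measure bO.
have [M M0 KM] := pinfty_ex_gt0 (compact_bounded cK).
have [C C0 kC] : exists2 C, 0 < C & forall p, `|k p| <= C.
  have ckK : compact (k @` K).
    by apply: continuous_compact cK; exact: continuous_subspaceT.
  have [C C0 kC] := pinfty_ex_gt0 (compact_bounded ckK).
  exists C => // p; have [Kp|nKp] := pselect (K p); first by apply: kC; exists p.
  by rewrite k0// normr0 ltW.
have [B hB] := bh M.
have mO : measurable Omega by exact: open_measurable_rV.
have mD : measurable (ocyl Omega : set (Rn * measurableTypeR R)).
  by apply: measurableX => //; exact: measurable_itv.
pose F : set (Rn * measurableTypeR R) := E `*` `[0, M].
have mF : measurable F by apply: measurableX => //; exact: measurable_itv.
have Foo : (st F < +oo)%E.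
  rewrite space_time_rect//.
  rewrite lte_mul_pinfty// ?ge0_fin_numE//.
  by rewrite lebesgue_measure_itv/=; case: ifP => // _; rewrite -EFinB ltry.
pose g : Rn * measurableTypeR R -> R := (cst (`|B| * C)) \_ F.
have ig : st.-integrable (ocyl Omega) (EFin \o g).
  apply: (@integrableS _ _ _ _ setT) => //.
  rewrite /g -restrict_EFin; apply/integrable_restrict => //; rewrite setTI.
  exact: integrable_cst_finite.
apply: le_integrable ig => //.
  apply/measurable_EFinP; apply: measurable_funM; first exact: measurable_ocyl_fun.
  by apply: measurable_ocyl_fun => //; exact: continuous_seqcont.
move=> [x t] [/= Ox]; rewrite in_itv/= andbT => t0.
rewrite lee_fin /g patchE normrM.
have [Kp|nKp] := pselect (K (x, t)); last by rewrite k0// normr0 mulr0.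
have tM : 0 <= t <= M.
  have /= := KM _ Kp; rewrite prod_normE ge_max => /andP[_ tM].
  by rewrite (ltW t0)/=; exact: le_trans (ler_norm _) tM.
rewrite mem_set//=; last by split; [exact: OE|rewrite /= in_itv].
rewrite [leRHS]ger0_norm; last by apply: mulr_ge0 => //; exact: ltW.
by apply: ler_pM => //; apply: le_trans (hB _ _ Ox tM) (ler_norm _).
Qed.

Definition dt psi : Rn * R -> R := 'D_(0 : Rn, 1 : R) psi.

Section test_function.
Variables (Omega : set Rn) (psi : Rn * R -> R).
Hypothesis tpsi : test_function (ocyl Omega) psi.

Let K := closure [set p | psi p != 0].

Lemma test_continuous : continuous psi.
Proof. by have [+ _ _] := tpsi => /(_ [::]) H p; have [] := H p I. Qed.

Lemma test_dt_continuous : continuous (dt psi).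
Proof. by have [+ _ _] := tpsi => /(_ [:: (0, 1)]) H p; have [] := H p I. Qed.

Lemma test_eq0 p : ~ K p -> psi p = 0.
Proof. by move=> nKp; apply/eqP; apply: contra_notT nKp => /= p0; exact: subset_closure. Qed.

Lemma test_dt_eq0 p : ~ K p -> dt psi p = 0.
Proof.
move=> nKp; have H : \forall q \near p, psi q = cst 0 q.
  have : \forall q \near p, (~` K) q.
    by apply: open_nbhs_nbhs; split => //; exact/closed_openC/closed_closure.
  by apply: filterS => q /test_eq0.
by rewrite /dt (near_eq_derive _ H) derive_cst.
Qed.

Lemma test_notin p : ~ ocyl Omega p -> ~ K p.
Proof. by have [_ _ KD] := tpsi => nD /KD. Qed.

Lemma test_is_derive x (t : R) :
  is_derive t 1 (fun s : R => psi (x, s)) (dt psi (x, t)).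
Proof.
have E s : (x, s) = s *: ((0, 1) : Rn * R) + (x, 0).
  by congr pair; rewrite /= ?scaler0 ?add0r// addr0 /GRing.scale/= mulr1.
have dpsi p : derivable psi p (0, 1).
  by have [+ _ _] := tpsi => /(_ [::]) /(_ p I)[_]; exact.
have := is_derive_line (dpsi (t *: ((0, 1) : Rn * R) + (x, 0))).
rewrite -E; congr (is_derive _ _ _ _); apply/funext => s; by rewrite -E.
Qed.

Lemma test_bounded : exists2 b : R, 0 < b & forall x t, b <= t -> ~ K (x, t).
Proof.
have [_ cK _] := tpsi; have [M M0 KM] := pinfty_ex_gt0 (compact_bounded cK).
exists (M + 1); first by rewrite addr_gt0.
move=> x t Mt /KM/=; rewrite prod_normE ge_max => /andP[_ tM].
have := le_trans (ler_norm _) tM => {}tM; have := le_trans Mt tM.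
by rewrite gerDl ler10.
Qed.

Lemma integrable_test h : open Omega -> bounded_set Omega ->
  seqcont (cyl Omega) h -> tbounded Omega h ->
  st.-integrable (ocyl Omega) (EFin \o (fun p => h p * psi p)).
Proof.
move=> oO bO ch bh; have [_ cK _] := tpsi.
apply: (integrable_compact_support oO bO ch bh test_continuous cK).
exact: test_eq0.
Qed.

Lemma integrable_dt_test h : open Omega -> bounded_set Omega ->
  seqcont (cyl Omega) h -> tbounded Omega h ->
  st.-integrable (ocyl Omega) (EFin \o (fun p => h p * dt psi p)).
Proof.
move=> oO bO ch bh; have [_ cK _] := tpsi.
apply: (integrable_compact_support oO bO ch bh test_dt_continuous cK).
exact: test_dt_eq0.
Qed.

(** By Fubini it is enough to integrate over time for fixed x, where the sum of
    the integrands is the derivative of f psi, and f psi vanishes at time 0 and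
    beyond the support of psi. *)
Lemma classical_distr f w : open Omega -> bounded_set Omega ->
  seqcont (cyl Omega) f -> tbounded Omega f ->
  seqcont (cyl Omega) w -> tbounded Omega w ->
  (forall x (t : R), Omega x -> 0 < t -> is_derive t 1 (fun s : R => f (x, s)) (w (x, t))) ->
  \int[st]_(p in ocyl Omega) (f p * dt psi p) +
  \int[st]_(p in ocyl Omega) (w p * psi p) = 0.
Proof.
move=> oO bO cf bf cw bw df.
have if1 := integrable_dt_test oO bO cf bf.
have iw1 := integrable_test oO bO cw bw.
have mD := measurable_ocyl oO.
rewrite -RintegralD//.
pose F p := f p * dt psi p + w p * psi p.
have iF : st.-integrable (ocyl Omega) (EFin \o F).
  by have := integrableD mD if1 iw1.
rewrite -[LHS]/(\int[st]_(p in ocyl Omega) F p).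
rewrite /Rintegral integral_mkcond.
have iFD : st.-integrable setT ((EFin \o F) \_ (ocyl Omega)).
  by apply/integrable_restrict => //; rewrite setTI.
have [b b0 Kb] := test_bounded.
have := integral12_prod_meas1 iFD.
move=> /(congr1 fine) <-.
rewrite (_ : (fun x => _) = cst 0%E) ?integral0//.
apply/funext => x /=.
have [Ox|nOx] := pselect (Omega x); last first.
  apply: integral0_eq => t _; rewrite patchE memNset//.
  by move=> [].
have cfx := seqcont_slice Ox cf; have cwx := seqcont_slice Ox cw.
have cpsi : seqcont (`[0, +oo[%classic : set R) (fun s => psi (x, s)).
  apply: continuous_seqcont => s; apply: differentiable_continuous.
  by apply/derivable1_diffP; have [] := test_is_derive x s.
have cdpsi : seqcont (`[0, +oo[%classic : set R) (fun s => dt psi (x, s)).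
  apply: continuous_seqcont => s.
  apply: (@continuous_comp _ _ _ (fun s => (x, s)) (dt psi)); last exact: test_dt_continuous.
  exact: (cvg_pair (@cvg_cst _ x _ (nbhs s) _) (@cvg_id _ (nbhs s))).
have cFx : seqcont (`[0, +oo[%classic : set R) (fun s => F (x, s)).
  exact: seqcontD (seqcontM cfx cdpsi) (seqcontM cwx cpsi).
have K0 : ~ K (x, 0) by apply: test_notin => -[_ /=]; rewrite in_itv/= ltxx.
transitivity (\int[lebesgue_measure]_(s in `[0%R, b]) (F (x, s))%:E)%E.
  rewrite [RHS]integral_mkcond; apply: eq_integral => s _.
  rewrite !patchE; have [s0|s0] := leP s 0.
    rewrite memNset/=; last by move=> [_ /=]; rewrite in_itv/= andbT ltNge s0.
    case: ifPn => //; rewrite inE/= in_itv/= => /andP[s0' _].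
    have -> : s = 0 by apply/eqP; rewrite eq_le s0.
    by rewrite /F test_eq0// test_dt_eq0// !mulr0 addr0.
  rewrite mem_set/=; last by split => //=; rewrite in_itv/= s0.
  case: ifPn => //; rewrite notin_setE/= in_itv/= (ltW s0)/= => /negP; rewrite -ltNge => bs.
  have nK := Kb x s (ltW bs).
  by rewrite /F test_eq0// test_dt_eq0// !mulr0 addr0.
have : (\int[lebesgue_measure]_(s in `[0%R, b]) (F (x, s))%:E)%E \is a fin_num.
  by apply: integrable_fin_num => //; exact: (integrable_itv b cFx).
move=> /fineK <-; congr EFin.
rewrite -[LHS]/(\int[lebesgue_measure]_(s in `[0, b]) F (x, s)).
have -> : \int[lebesgue_measure]_(s in `[0, b]) F (x, s) =
    f (x, b) * psi (x, b) - f (x, 0) * psi (x, 0).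
  apply: (@FTC2_nneg _ (fun s => f (x, s) * psi (x, s))) => //; first exact: seqcontM.
  move=> t t0; have := is_deriveM (df x t Ox t0) (test_is_derive x t).
  by congr (is_derive _ _ _ _); rewrite /F /GRing.scale/=; ring.
by rewrite !test_eq0 ?mulr0 ?subrr//; exact: Kb.
Qed.

End test_function.

End distributions.

(** * From distributional time derivatives to the integrated equation *)

Section distributional_ode.
Context {R : realType} {n : nat}.
Local Notation Rn := 'rV[R]_n.
Local Notation st := (@space_time R n).
Variable Omega : set Rn.
Hypotheses (oO : open Omega) (bO : bounded_set Omega).
Implicit Types (f w h k psi W : Rn * R -> R).

Lemma seqcont_cst c : seqcont (cyl Omega) (fun=> c : R).
Proof. by move=> u p _ _ _; exact: cvg_cst. Qed.

Lemma tbounded_cst c : tbounded Omega (fun=> c : R).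
Proof. by move=> T; exists `|c|. Qed.

Lemma tboundedB f g : tbounded Omega f -> tbounded Omega g ->
  tbounded Omega (fun p => f p - g p).
Proof.
move=> bf bg T; have [B fB] := bf T; have [C gC] := bg T; exists (B + C) => x t Ox tT.
by apply: le_trans (ler_normB _ _) _; apply: lerD; [exact: fB|exact: gC].
Qed.

(** The same radius serves for space and time, and keeps the space ball inside
    Omega. *)
Lemma near_ocyl_ball W x0 (t0 : R) (P : R -> Prop) : seqcont (cyl Omega) W ->
  Omega x0 -> 0 < t0 -> (\forall s \near W (x0, t0), P s) ->
  exists2 e : R, 0 < e & forall x t, ball x0 e x -> ball t0 e t ->
    Omega x /\ P (W (x, t)).
Proof.
move=> cW Ox0 t00 Pn.
have D : nbhs (x0, t0) (ocyl Omega).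
  apply: open_nbhs_nbhs; split; first exact: open_ocyl.
  by split => //=; rewrite in_itv/= t00.
have D' : nbhs (x0, t0) (cyl Omega) by apply: filterS D; exact: ocyl_sub.
have H := seqcont_nbhs cW D' Pn.
have [e /= e0 He] := iffLR (nbhs_ballP _ _) (filterI D H).
exists e => // x t xe te.
by have [[Ox _] PW] := He (x, t) (conj xe te).
Qed.

(** If W(x0,a) < c < W(x0,b), take a test function chi(x) eta(t) with chi >= 0
    concentrated near x0, and eta' >= 0 near a, eta' <= 0 near b and zero
    elsewhere. The constant c integrates to zero against its time derivative,
    as W does, yet (c - W) times that derivative is nonnegative, and positive
    near (x0,a). *)
Lemma distr_dt0_nincr W x0 (a b : R) :
  seqcont (cyl Omega) W -> tbounded Omega W ->
  (forall psi, test_function (ocyl Omega) psi ->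
     \int[st]_(p in ocyl Omega) (W p * dt psi p) = 0) ->
  Omega x0 -> 0 < a -> a < b -> W (x0, b) <= W (x0, a).
Proof.
move=> cW bW W0 Ox0 a0 ab; rewrite leNgt; apply/negP => Wab.
pose c := (W (x0, a) + W (x0, b)) / 2.
have Wac : W (x0, a) < c by rewrite midf_lt.
have Wcb : c < W (x0, b) by rewrite midf_lt.
have [e1 e10 H1] := near_ocyl_ball cW Ox0 a0 (lt_nbhsl Wac).
have [e2 e20 H2] := near_ocyl_ball cW Ox0 (lt_trans a0 ab) (lt_nbhsr Wcb).
pose r := Num.min (Num.min e1 e2) (Num.min a (b - a)) / 2.
have [r0 re1 re2 ra rba] : [/\ 0 < r, r < e1, r < e2, r < a & r *+ 2 <= b - a].
  have m0 : 0 < Num.min (Num.min e1 e2) (Num.min a (b - a)).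
    by rewrite !lt_min e10 e20 a0 subr_gt0.
  have : r *+ 2 = Num.min (Num.min e1 e2) (Num.min a (b - a)).
    by rewrite /r -mulr_natr divfK.
  have : 0 < r by rewrite divr_gt0.
  set m := Num.min _ _ in m0 * => r0 rm.
  have m1 : m <= e1 by rewrite /m !ge_min lexx.
  have m2 : m <= e2 by rewrite /m !ge_min lexx orbT.
  have m3 : m <= a by rewrite /m !ge_min lexx !orbT.
  have m4 : m <= b - a by rewrite /m !ge_min lexx !orbT.
  split => //; lra.
have [al [be [eta [al0 be0 Se deta eta0]]]] :
    exists al be (eta : R -> R), [/\ 0 < al, 0 < be, smooth_alg eta,
    forall t : R, is_derive t 1 eta (al * window (a - r) (a + r) t - be * window (b - r) (b + r) t) &
    forall t, ~~ (a - r < t < b + r) -> eta t = 0].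
  apply: exists_time_test; lra.
pose x1 := x0 - const_mx r; pose x2 := x0 + const_mx r.
pose chi (x : Rn) := \prod_(i < n) window (x1 0 i) (x2 0 i) (x 0 i).
pose psi (p : Rn * R) := chi p.1 * eta p.2.
have tpsi : test_function (ocyl Omega) psi.
  apply: (test_function_box_window Se eta0) => x t Hx /andP[at1 tb].
  split; last by rewrite /= in_itv/= andbT; apply: lt_le_trans at1; rewrite subr_gt0.
  have xb : ball x0 e1 x.
    split => // i j; rewrite ord1 /ball/= ltr_distlC.
    by have := Hx j; rewrite !mxE; lra.
  by have [] := H1 x a xb (ballxx _ e10).
have dpsi p : dt psi p = chi p.1 * (al * window (a - r) (a + r) p.2 - be * window (b - r) (b + r) p.2).
  by case: p => x t; have := is_derive_time chi x (deta t) => H; apply: derive_val.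
have I0 := W0 psi tpsi.
have I1 : \int[st]_(p in ocyl Omega) (c * dt psi p) = 0.
  have := @classical_distr R n Omega psi tpsi (fun=> c) (fun=> 0) oO bO
    (@seqcont_cst c) (@tbounded_cst c) (@seqcont_cst 0) (@tbounded_cst 0) _.
  rewrite [X in _ + X](_ : _ = 0) ?addr0.
    by apply => x t _ _; exact: is_derive_cst.
  rewrite (@eq_Rintegral _ _ _ st _ (fun=> 0)); first by rewrite Rintegral_cst ?mul0r//; exact: measurable_ocyl.
  by move=> p _; rewrite mul0r.
have i1 : st.-integrable (ocyl Omega) (EFin \o (fun p => c * dt psi p)).
  exact: (integrable_dt_test tpsi oO bO (@seqcont_cst c) (@tbounded_cst c)).
have i2 : st.-integrable (ocyl Omega) (EFin \o (fun p => W p * dt psi p)).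
  exact: (integrable_dt_test tpsi oO bO cW bW).
have chi0 x : 0 <= chi x by apply: prodr_ge0 => i _; exact: window_ge0.
have chiN x : chi x != 0 -> forall i, x1 0 i < x 0 i < x2 0 i.
  move=> /prodf_neq0 chix i; apply: contraT => /window_eq0 H.
  by have := chix i isT; rewrite H eqxx.
have mD := measurable_ocyl oO.
have : 0 < \int[st]_(p in ocyl Omega) ((c - W p) * dt psi p).
  apply: (@Rintegral_gt0 R _ _ st _ (boxo x1 x2 `*` `]a - r, a + r[)) => //.
  - by apply: measurableX => //; apply: open_measurable_rV; exact: open_boxo.
  - move=> [x t] [/= xb]; rewrite in_itv/= => /andP[at1 _].
    split; last by rewrite /= in_itv/= andbT; apply: lt_trans at1; rewrite subr_gt0.
    have xb1 : ball x0 e1 x.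
      split => // i j; rewrite ord1 /ball/= ltr_distlC.
      by have := xb j; rewrite !mxE; lra.
    by have [] := H1 x a xb1 (ballxx _ e10).
  - have -> : st (boxo x1 x2 `*` `]a - r, a + r[) =
        ((\prod_(i < n) (r *+ 2))%:E * (r *+ 2)%:E)%E.
      rewrite space_time_rect//; last by apply: open_measurable_rV; exact: open_boxo.
      rewrite lebesgue_rV_box; last by move=> i; rewrite !mxE; lra.
      rewrite lebesgue_measure_itv/= lte_fin ifT; last lra.
      congr (_%:E * _)%E; last by rewrite -EFinB; congr EFin; ring.
      by apply: eq_bigr => i _; rewrite !mxE; ring.
    rewrite -EFinM eqe mulf_neq0//; last by rewrite mulrn_eq0/= gt_eqF.
    by apply/prodf_neq0 => i _; rewrite mulrn_eq0/= gt_eqF.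
  - rewrite (_ : _ \o _ = fun p => ((c * dt psi p)%:E - (W p * dt psi p)%:E)%E).
      exact: (integrableB mD i1 i2).
    by apply/funext => p; rewrite /= mulrBl EFinB.
  - move=> [x t] _; rewrite dpsi /=; have [->|/chiN xb] := eqVneq (chi x) 0.
      by rewrite mul0r mulr0.
    have xb1 e : r < e -> ball x0 e x.
      move=> re; split; first exact: lt_trans re.
      move=> i j; rewrite ord1 /ball/= ltr_distlC.
      by have := xb j; rewrite !mxE; lra.
    rewrite mulrCA; apply: mulr_ge0 => //.
    have [ta|ta] := boolP (a - r < t < a + r).
      rewrite [window (b - r) _ _]window_eq0 ?mulr0 ?subr0; last first.
        by apply/negP => /andP[tb _]; move: ta tb rba; lra.
      apply: mulr_ge0; last by apply: mulr_ge0; [exact: ltW|exact: window_ge0].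
      rewrite subr_ge0 ltW//.
      have te : ball a e1 t by rewrite /ball/= ltr_distlC; move: ta re1; lra.
      by have [] := H1 x t (xb1 _ re1) te.
    rewrite (window_eq0 ta) mulr0 sub0r.
    have [tb|tb] := boolP (b - r < t < b + r); last by rewrite (window_eq0 tb) !mulr0 oppr0 mulr0.
    rewrite mulrN -mulNr; apply: mulr_ge0; last by apply: mulr_ge0; [exact: ltW|exact: window_ge0].
    rewrite oppr_ge0 subr_le0 ltW//.
    have te : ball b e2 t by rewrite /ball/= ltr_distlC; move: tb re2; lra.
    by have [] := H2 x t (xb1 _ re2) te.
  - move=> [x t] [/= xb]; rewrite in_itv/= => ta; rewrite dpsi/=.
    rewrite [window (b - r) _ _]window_eq0 ?mulr0 ?subr0; last first.
      by apply/negP => /andP[tb _]; move: ta tb rba; lra.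
    have xb1 : ball x0 e1 x.
      split => // i j; rewrite ord1 /ball/= ltr_distlC.
      by have := xb j; rewrite !mxE; lra.
    have te : ball a e1 t by rewrite /ball/= ltr_distlC; move: ta re1; lra.
    have [_ Wc] := H1 x t xb1 te.
    apply: mulr_gt0; first by rewrite subr_gt0.
    apply: mulr_gt0; last by apply: mulr_gt0 => //; exact: window_gt0.
    by apply: prodr_gt0 => i _; apply: window_gt0; exact: xb.
rewrite (@eq_Rintegral _ _ _ st _ (fun p => c * dt psi p - W p * dt psi p)).
  by rewrite RintegralB// I0 I1 subr0 ltxx.
by move=> p _; rewrite mulrBl.
Qed.

Lemma tbounded_prim w : seqcont (cyl Omega) w -> tbounded Omega w ->
  tbounded Omega (prim w).
Proof.
move=> cw bw T; have [B wB] := bw T.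
exists (`|B| * ((expR (1 * T) - 1) / 1)) => x t Ox /andP[t0 tT].
have B0 s : 0 <= s <= t -> `|w (x, s)| <= `|B| * expR (1 * s).
  move=> /andP[s0 st]; apply: (@le_trans _ _ `|B|).
    by apply: le_trans (wB _ _ Ox _) (ler_norm _); rewrite s0 (le_trans st).
  by rewrite ler_peMr// mul1r -expR0 ler_expR.
apply: le_trans (prim_bound Ox cw ltr01 t0 B0) _.
by apply: ler_wpM2l => //; rewrite !divr1 lerB// ler_expR !mul1r.
Qed.

(** Applied to W = f - prim w and to - W, the monotonicity lemma shows that W(x,.)
    is constant on positive times; continuity reaches time 0. *)
Lemma distr_mild f w x (t : R) :
  seqcont (cyl Omega) f -> tbounded Omega f ->
  seqcont (cyl Omega) w -> tbounded Omega w ->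
  distr_dt_eq (ocyl Omega) f w -> Omega x -> 0 <= t ->
  f (x, t) = f (x, 0) + prim w (x, t).
Proof.
move=> cf bf cw bw fw Ox.
have cP := seqcont_prim cw bw.
have bP : tbounded Omega (prim w) by apply: tbounded_prim.
pose W p := f p - prim w p.
have cW : seqcont (cyl Omega) W by exact: seqcontB.
have bW : tbounded Omega W by exact: tboundedB.
have W0 psi : test_function (ocyl Omega) psi ->
     \int[st]_(p in ocyl Omega) (W p * dt psi p) = 0.
  move=> tpsi; have mD := measurable_ocyl oO.
  have i1 := integrable_dt_test tpsi oO bO cf bf.
  have i2 := integrable_dt_test tpsi oO bO cP bP.
  have H1 := classical_distr tpsi oO bO cP bP cw bw
    (fun x t Ox t0 => is_derive_prim Ox cw t0).
  have H2 := fw psi tpsi.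
  rewrite (@eq_Rintegral _ _ _ st _ (fun p => f p * dt psi p - prim w p * dt psi p)); last first.
    by move=> p _; rewrite mulrBl.
  rewrite RintegralB//.
  have /eqP := H1; rewrite -H2 subr_eq0 => /eqP ->.
  exact: subrr.
have Wc (s1 s2 : R) : 0 < s1 -> s1 < s2 -> W (x, s2) = W (x, s1).
  move=> s10 s12; apply/eqP; rewrite eq_le; apply/andP; split.
    exact: distr_dt0_nincr.
  have := @distr_dt0_nincr (fun p => 0 - W p) x s1 s2 _ _ _ Ox s10 s12.
  rewrite !sub0r lerN2; apply.
  - apply: seqcontB cW; exact: seqcont_cst.
  - apply: tboundedB bW; exact: tbounded_cst.
  - move=> psi tpsi; rewrite (@eq_Rintegral _ _ _ st _ (fun p => -1 * (W p * dt psi p))).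
      rewrite RintegralZl ?W0 ?mulr0//; first exact: measurable_ocyl.
      exact: (integrable_dt_test tpsi oO bO cW bW).
    by move=> p _; rewrite sub0r mulN1r mulNr.
rewrite le_eqVlt => /predU1P[<-|t0]; first by rewrite prim0 addr0.
apply/eqP; rewrite -subr_eq; apply/eqP.
rewrite -[LHS]/(W (x, t)).
have W00 : W (x, 0) = f (x, 0) by rewrite /W prim0 subr0.
rewrite -W00.
have l1 : W (x, t / k.+1%:R) @[k --> \oo] --> W (x, 0).
  apply: (seqcont_slice Ox cW).
  - by move=> k /=; rewrite in_itv/= divr_ge0// ltW.
  - by rewrite /= in_itv/= lexx.
  - by rewrite -(mulr0 t); apply: cvgMr; exact: cvg_harmonic.
have l2 : W (x, t / k.+1%:R) @[k --> \oo] --> W (x, t).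
  apply: cvg_near_cst; apply: nearW => -[|k]; first by rewrite divr1.
  apply/esym; apply: Wc.
    by rewrite divr_gt0.
  by rewrite ltr_pdivrMr// ltr_pMr// ltr1n.
exact: (cvg_unique _ l2 l1).
Qed.
End distributional_ode.

(** * Fixed points in a weighted norm *)

(** Lets estimates with a factor 2^(-k) pass to the limit without mentioning
    limits. *)
Lemma le_geometric_le0 (R : realType) (c x : R) :
  (forall k, x <= c * 2^-1 ^+ k) -> x <= 0.
Proof.
move=> xc; rewrite leNgt; apply/negP => x0.
have := xc (Num.truncn (c / x)); apply/negP; rewrite -ltNge.
set k := Num.truncn _.
rewrite exprVn ltr_pdivrMr ?exprn_gt0// mulrC -ltr_pdivrMr//.
apply: lt_le_trans (truncnS_gt _) _; rewrite -/k -natrX ler_nat.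
exact: ltn_expl.
Qed.

(** Banach's fixed point theorem for the weighted norm sup |f| / wt over D, on a
    set P of admissible functions. *)
Section picard.
Context {R : realType} {Y : Type}.
Variables (D : set Y) (wt : Y -> R) (P : set (Y -> R)) (T : (Y -> R) -> Y -> R).
Variables (z0 : Y -> R) (C : R).
Hypotheses (wt0 : forall y, 0 <= wt y) (C0 : 0 <= C).
Hypothesis PT : forall f, P f -> P (T f).
Hypothesis T_contract : forall f g N, 0 <= N -> P f -> P g ->
  (forall y, D y -> `|f y - g y| <= N * wt y) ->
  forall y, D y -> `|T f y - T g y| <= N / 2 * wt y.
Hypothesis Pz0 : P z0.
Hypothesis z0C : forall y, D y -> `|T z0 y - z0 y| <= C * wt y.
Hypothesis Pclosed : forall (f : nat -> Y -> R) g, (forall k, P (f k)) ->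
  (forall k y, D y -> `|f k y - g y| <= 2 * C * 2^-1 ^+ k * wt y) -> P g.

Lemma picard_fixpoint : exists f, P f /\ forall y, D y -> T f y = f y.
Proof.
pose f k := iter k T z0.
have Pf k : P (f k) by elim: k => //= k; exact: PT.
pose e k : R := 2^-1 ^+ k.
have e0 k : 0 <= e k by rewrite exprn_ge0.
have eS k : e k = 2 * e k.+1 by rewrite /e exprS; move: (_ ^+ k) => x; lra.
have step k y : D y -> `|f k.+1 y - f k y| <= C * e k * wt y.
  elim: k y => [|k IH] y Dy; first by rewrite /e expr0 mulr1; exact: z0C.
  have := T_contract (mulr_ge0 C0 (e0 k)) (Pf k.+1) (Pf k) IH Dy.
  by rewrite /e exprS mulrCA [2^-1 * _]mulrC.
have gap k m y : D y -> `|f (k + m)%N y - f k y| <= 2 * C * (e k - e (k + m)%N) * wt y.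
  move=> Dy; elim: m => [|m IH]; first by rewrite addn0 !subrr normr0 mulr0 mul0r.
  rewrite addnS -[f _ y - _](subrKA (f (k + m)%N y)); apply: le_trans (ler_normD _ _) _.
  rewrite addrC; apply: le_trans (lerD IH (step _ _ Dy)) _.
  rewrite -mulrDl ler_wpM2r// (eS (k + m)%N); lra.
pose a k y := f k y - 2 * C * e k * wt y.
have ab j k y : D y -> a j y <= f k y + 2 * C * e k * wt y.
  move=> Dy; rewrite /a; have Cw : 0 <= C * wt y by rewrite mulr_ge0.
  have [jk|/ltnW kj] := leqP k j.
    have := gap k (j - k)%N y Dy; rewrite subnKC// ler_norml => /andP[_].
    have := mulr_ge0 Cw (e0 j); lra.
  have := gap j (k - j)%N y Dy; rewrite subnKC// ler_norml => /andP[+ _].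
  have := mulr_ge0 Cw (e0 k); lra.
(* Every left end f k y - 2 C 2^-k wt y is below every right end
   f j y + 2 C 2^-j wt y, so the supremum of the left ends lies in all these
   intervals. *)
pose g y := sup (range (fun k => a k y)).
have fg k y : D y -> `|f k y - g y| <= 2 * C * e k * wt y.
  move=> Dy; have ub : has_sup (range (fun k => a k y)).
    split; first by exists (a 0%N y), 0%N.
    by exists (f 0%N y + 2 * C * e 0%N * wt y) => _ [j _ <-]; exact: ab.
  rewrite ler_distlC; apply/andP; split.
    by apply: ub_le_sup; [case: ub|exists k].
  by apply: ge_sup; [case: ub|move=> _ [j _ <-]; exact: ab].
have Pg : P g := Pclosed Pf fg.
exists g; split => // y Dy; apply/eqP; rewrite -subr_eq0 -normr_le0.
apply: (@le_geometric_le0 _ (4 * C * wt y)) => k.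
have c0 : 0 <= 2 * C * e k by rewrite !mulr_ge0.
have := T_contract c0 (Pf k) Pg (fg k) Dy.
have := fg k.+1 y Dy; rewrite -[T (f k) y]/(f k.+1 y) (eS k) -/(e k) (eS k).
rewrite ler_norml => /andP[h1 h2]; rewrite ler_norml => /andP[h3 h4].
have := mulr_ge0 (mulr_ge0 C0 (e0 k.+1)) (wt0 y).
by rewrite ler_norml; lra.
Qed.

End picard.

(** * The integrated Dirichlet problem *)

Lemma bounded_near_ex (R : realType) (T : Type) (S : set T) (f : T -> R) :
  [bounded f x | x in S] <-> exists2 M, 0 <= M & forall x, S x -> `|f x| <= M.
Proof.
split=> [/pinfty_ex_gt0[M M0 fM]|[M M0 fM]]; first by exists M => //; exact: ltW.
exists M; split; first exact: num_real.
by move=> N MN x /= Sx; apply: le_trans (fM x Sx) (ltW MN).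
Qed.

Section nonlocal.
Context {R : realType} {n : nat}.
Local Notation Rn := 'rV[R]_n.
Local Notation lam := (lebesgue_rV n).
Variables (Omega : set Rn) (mu : Rn -> R).
Hypotheses (hO : regular_domain Omega) (dmu : is_density mu).
Implicit Types (f g w : Rn * R -> R).

Local Notation A := (closure Omega).
Local Notation ext := (ext_frontier mu Omega).

Let oO : open Omega. Proof. by have [] := hO. Qed.
Let bO : bounded_set Omega. Proof. by have [] := hO. Qed.

Lemma measurable_domain : measurable Omega.
Proof. exact: open_measurable_rV. Qed.

Lemma measurable_ext_frontier : measurable ext.
Proof.
apply: measurableD; last exact: measurable_domain.
by apply: closed_measurable_rV; exact: closed_closure.
Qed.

(** The domain of influence is closed, and the translate by z of Omega lies in
    it. *)
Lemma closure_add_supp (x z : Rn) : A x -> supp mu z -> influence mu Omega (x + z).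
Proof.
move=> Ax sz B Bxz.
have c1 : y + z @[y --> x] --> x + z.
  exact: (cvgD (@cvg_id _ (nbhs x)) (@cvg_cst _ z _ (nbhs x) _)).
have [y [Oy By]] := Ax _ (c1 B Bxz).
by exists (y + z); split => //; exists y => //; exists z.
Qed.

(** Only the points z with x0 + z on the boundary of Omega can misbehave, and
    they form a translate of a null set. *)
Lemma ae_interior (x : nat -> Rn) (x0 : Rn) : x @ \oo --> x0 ->
  {ae lam, forall z,
    (Omega (x0 + z) -> \forall k \near \oo, Omega (x k + z)) /\
    (~ Omega (x0 + z) -> \forall k \near \oo, ~ Omega (x k + z))}.
Proof.
move=> xx0.
have [_ _ _ hS] := hO.
have := negligible_addl_preimage x0 (smooth_boundary_negligible oO hS).
apply: negligibleS => z /= nz; apply: contrapT => nb; apply: nz.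
have xz : x k + z @[k --> \oo] --> x0 + z.
  exact: (cvgD xx0 (@cvg_cst _ z _ \oo _)).
split=> Oz.
  by apply: (xz Omega); apply: open_nbhs_nbhs; split.
have nA : ~ A (x0 + z).
  by move=> Az; apply: nb; split => // /interior_subset.
have : \forall k \near \oo, (~` A) (x k + z).
  apply: (xz (~` A)); apply: open_nbhs_nbhs; split => //.
  exact/closed_openC/closed_closure.
by apply: filterS => k /= + Ok; apply; exact: subset_closure.
Qed.

Lemma seqcont_avg_domain f : seqcont (cyl Omega) f -> tbounded Omega f ->
  seqcont (cyl A) (avg mu Omega f).
Proof.
move=> cf bf; apply: seqcont_avg => //; first exact: measurable_domain.
move=> x x0 _ _ xx0; have := ae_interior xx0.
by apply: filterS.
Qed.

(** For z in the support of mu, the points x + z with x in the closure of Omega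
    stay in the domain of influence, so that they can leave the extended
    frontier only by entering Omega. *)
Lemma seqcont_avg_ext f : seqcont (cyl ext) f -> tbounded ext f ->
  seqcont (cyl A) (avg mu ext f).
Proof.
move=> cf bf; apply: seqcont_avg => //; first exact: measurable_ext_frontier.
move=> x x0 xA x0A xx0.
have h1 := ae_interior xx0.
have h2 : {ae lam, forall z, mu z != 0 -> supp mu z}.
  apply: negligibleS (density_supp_negligible dmu) => z /= nz.
  by apply: contrapT => nz'; apply: nz => m0; apply: contrapT => ns; apply: nz'.
apply: filterS2 h1 h2 => z [On Onn] ms m0; have sz := ms m0; split.
  move=> [_ /Onn]; apply: filterS => k nO; split => //.
  exact: closure_add_supp.
move=> nE; have : Omega (x0 + z).
  by apply: contrapT => nO; apply: nE; split => //; exact: closure_add_supp.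
by move=> /On; apply: filterS => k Ok [].
Qed.

Definition mass (S : set Rn) (x : Rn) : R := \int[lam]_(z in [set z | S (x + z)]) mu z.

Lemma mass_ge0 S x : 0 <= mass S x.
Proof. by have [_ mu0 _] := dmu; apply: Rintegral_ge0. Qed.

Lemma mass_domain_ext x : mass Omega x + mass ext x <= 1.
Proof.
have [imu mu0 mu1] := dmu.
have m1 := measurable_addl_preimage x measurable_domain.
have m2 := measurable_addl_preimage x measurable_ext_frontier.
rewrite /mass -Rintegral_setU//.
- have <- : \int[lam]_z mu z = 1 by rewrite /Rintegral mu1.
  rewrite Rintegral_mkcond.
  apply: le_Rintegral => //.
  + rewrite -restrict_EFin; apply/integrable_restrict => //; first exact: measurableU.
    by rewrite setTI; apply: integrableS imu => //; exact: measurableU.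
  + by move=> z _; rewrite patchE; case: ifP.
- by apply: integrableS imu => //; exact: measurableU.
- by apply/disj_setPS => z [/= Oz [_]].
Qed.

Lemma tbounded_avg S f : measurable S -> seqcont (cyl S) f -> tbounded S f ->
  (forall x, mass S x <= 1) -> tbounded A (avg mu S f).
Proof.
move=> mS cf bf S1 T; have [B fB] := bf T; exists `|B| => x t Ax /andP[t0 tT].
apply: le_trans (avg_bound x dmu mS t0 cf (B := `|B|) _) _.
  by move=> y Sy; apply: le_trans (fB _ _ Sy _) (ler_norm _); rewrite t0.
by rewrite ler_piMr// S1.
Qed.

Lemma mass_domain_le1 x : mass Omega x <= 1.
Proof. by apply: le_trans (mass_domain_ext x); rewrite lerDl mass_ge0. Qed.

Lemma mass_ext_le1 x : mass ext x <= 1.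
Proof. by apply: le_trans (mass_domain_ext x); rewrite lerDr mass_ge0. Qed.

Lemma avgB S f g (x : Rn) (t : R) : measurable S -> 0 <= t ->
  seqcont (cyl S) f -> tbounded S f -> seqcont (cyl S) g -> tbounded S g ->
  avg mu S f (x, t) - avg mu S g (x, t) = avg mu S (fun p => f p - g p) (x, t).
Proof.
move=> mS t0 cf bf cg bg; have [B fB] := bf t; have [C gC] := bg t.
have tt : 0 <= t <= t by rewrite t0 lexx.
rewrite /avg/= -RintegralB//.
- by apply: eq_Rintegral => z _; rewrite mulrBl.
- exact: measurable_addl_preimage.
- by apply: (integrable_avg x dmu mS t0 cf (B := B)) => y Sy; exact: fB.
- by apply: (integrable_avg x dmu mS t0 cg (B := C)) => y Sy; exact: gC.
Qed.

Lemma avgZ S f (c : R -> R) (x : Rn) (t : R) : measurable S -> 0 <= t ->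
  seqcont (cyl S) f -> tbounded S f ->
  avg mu S (fun p => c p.2 * f p) (x, t) = c t * avg mu S f (x, t).
Proof.
move=> mS t0 cf bf; have [B fB] := bf t.
have tt : 0 <= t <= t by rewrite t0 lexx.
rewrite /avg/= -RintegralZl//.
- by apply: eq_Rintegral => z _; rewrite mulrA.
- exact: measurable_addl_preimage.
- by apply: (integrable_avg x dmu mS t0 cf (B := B)) => y Sy; exact: fB.
Qed.

Lemma primB f g (x : Rn) (t : R) : A x -> seqcont (cyl A) f -> seqcont (cyl A) g ->
  prim f (x, t) - prim g (x, t) = prim (fun p => f p - g p) (x, t).
Proof.
move=> Ax cf cg; rewrite /prim/= -RintegralB//.
  exact: (integrable_itv t (seqcont_slice Ax cf)).
exact: (integrable_itv t (seqcont_slice Ax cg)).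
Qed.

Lemma seqcont_time (S : set (Rn * R)) (c : R -> R) : continuous c ->
  seqcont S (fun p => c p.2).
Proof.
move=> cc u p _ _ up; apply: (cvg_comp _ _ (cvg_comp _ _ up cvg_snd)); exact: cc.
Qed.

Lemma seqcont_space (c : Rn -> R) : {within A, continuous c} ->
  seqcont (cyl A) (fun p => c p.1).
Proof.
move=> /within_continuous_seqcont cc u p uA pA up; apply: (cc (fun k => (u k).1)).
- by move=> k; have [] := uA k.
- by have [] := pA.
- exact: (cvg_comp _ _ up cvg_fst).
Qed.

Lemma cyl_domainS : cyl Omega `<=` cyl A.
Proof. by move=> p [Op p2]; split => //; exact: subset_closure. Qed.

Lemma tboundedS (S S' : set Rn) f : S' `<=` S -> tbounded S f -> tbounded S' f.
Proof. by move=> SS bf T; have [B fB] := bf T; exists B => x t /SS; exact: fB. Qed.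

Lemma exp_tbounded (S : set Rn) f (M : R) :
  (forall x t, S x -> 0 <= t -> `|f (x, t)| <= M * expR t) -> tbounded S f.
Proof.
move=> fM T; exists (`|M| * expR T) => x t Sx /andP[t0 tT].
apply: le_trans (fM x t Sx t0) _; apply: (@le_trans _ _ (`|M| * expR t)).
  by rewrite ler_wpM2r ?expR_ge0// ler_norm.
by rewrite ler_wpM2l// ler_expR.
Qed.

Section existence.
Variables (u0 : Rn -> R) (phi : Rn * R -> R) (M : R).
Hypotheses (M0 : 0 <= M) (cu0 : {within A, continuous u0})
  (u0M : forall x, A x -> `|u0 x| <= M)
  (cphi : seqcont (cyl ext) phi)
  (phiM : forall p, cyl ext p -> `|phi p| <= M).

Let bphi : tbounded ext phi.
Proof.
move=> T; exists M => x t Ex /andP[t0 _]; apply: phiM; split => //=.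
by rewrite in_itv/= t0.
Qed.

(** The right-hand side of the equation for z = e^t u. *)
Definition source z (p : Rn * R) : R :=
  avg mu Omega z p + expR p.2 * avg mu ext phi p.

Definition mild_map z (p : Rn * R) : R := u0 p.1 + prim (source z) p.

Definition admissible z : Prop := seqcont (cyl A) z /\
  forall x t, A x -> 0 <= t -> `|z (x, t)| <= M * expR t.

Lemma admissible_domain z : admissible z ->
  seqcont (cyl Omega) z /\ tbounded Omega z.
Proof.
move=> [cz zM]; split; first exact: seqcontS cyl_domainS cz.
by apply: (@tboundedS A); [exact: subset_closure|exact: exp_tbounded zM].
Qed.

Lemma seqcont_source z : admissible z -> seqcont (cyl A) (source z).
Proof.
move=> /admissible_domain[cz bz]; apply: seqcontD; first exact: seqcont_avg_domain.
apply: seqcontM; last exact: seqcont_avg_ext.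
by apply: seqcont_time => t; exact: continuous_expR.
Qed.

Lemma source_bound z x t : admissible z -> A x -> 0 <= t ->
  `|source z (x, t)| <= M * expR t.
Proof.
move=> az Ax t0; have [cz bz] := admissible_domain az.
have h1 : `|avg mu Omega z (x, t)| <= M * expR t * mass Omega x.
  apply: avg_bound => //; first exact: measurable_domain.
  by move=> y Oy; apply: az.2 => //; exact: subset_closure.
have h2 : `|avg mu ext phi (x, t)| <= M * mass ext x.
  apply: avg_bound => //; first exact: measurable_ext_frontier.
  by move=> y Ey; apply: phiM; split => //=; rewrite in_itv/= t0.
apply: le_trans (ler_normD _ _) _; rewrite normrM (ger0_norm (expR_ge0 _))/=.
have et := expR_ge0 t; have := ler_wpM2l et h2.
have := ler_wpM2l (mulr_ge0 M0 et) (mass_domain_ext x); lra.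
Qed.

Lemma seqcont_mild_map z : admissible z -> seqcont (cyl A) (mild_map z).
Proof.
move=> az; apply: seqcontD; first exact: seqcont_space.
apply: seqcont_prim; first exact: seqcont_source.
by apply: (@exp_tbounded _ _ M) => x t; exact: source_bound.
Qed.

Lemma admissible_mild_map z : admissible z -> admissible (mild_map z).
Proof.
move=> az; split; first exact: seqcont_mild_map.
move=> x t Ax t0; apply: le_trans (ler_normD _ _) _ => /=.
have sb s : 0 <= s <= t -> `|source z (x, s)| <= M * expR (1 * s).
  by move=> /andP[s0 _]; rewrite mul1r; exact: source_bound.
have := prim_bound Ax (seqcont_source az) ltr01 t0 sb.
have := u0M Ax; rewrite mul1r divr1; lra.
Qed.

Let wt (p : Rn * R) := expR (2 * p.2).

(** The boundary terms cancel and averaging does not increase the weighted norm;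
    integrating e^(2s) yields the factor 1/2. *)
Lemma mild_map_contract z z' N : 0 <= N -> admissible z -> admissible z' ->
  (forall p, cyl A p -> `|z p - z' p| <= N * wt p) ->
  forall p, cyl A p -> `|mild_map z p - mild_map z' p| <= N / 2 * wt p.
Proof.
move=> N0 az az' zz' [x t] [/= Ax]; rewrite in_itv/= andbT => t0.
have [cz bz] := admissible_domain az; have [cz' bz'] := admissible_domain az'.
have cs := seqcont_source az; have cs' := seqcont_source az'.
have cd : seqcont (cyl A) (fun p => source z p - source z' p).
  exact: seqcontB.
rewrite /mild_map/= opprD addrACA subrr add0r primB//.
have sb s : 0 <= s <= t -> `|source z (x, s) - source z' (x, s)| <= N * expR (2 * s).
  move=> /andP[s0 _]; rewrite /source opprD addrACA subrr addr0.
  rewrite avgB//; last exact: measurable_domain.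
  apply: le_trans (avg_bound x dmu measurable_domain s0 (B := N * expR (2 * s)) _ _) _.
  - exact: seqcontB.
  - move=> y Oy; apply: (zz' (y, s)); split => /=; first exact: subset_closure.
    by rewrite in_itv/= s0.
  - by rewrite ler_piMr ?mulr_ge0 ?expR_ge0// mass_domain_le1.
apply: le_trans (prim_bound Ax cd (ltr0n _ 2) t0 sb) _.
rewrite /wt/=; lra.
Qed.

Lemma admissible_closed (f : nat -> Rn * R -> R) z :
  (forall k, admissible (f k)) ->
  (forall k p, cyl A p -> `|f k p - z p| <= 2 * M * 2^-1 ^+ k * wt p) ->
  admissible z.
Proof.
move=> af fz; split.
- move=> u p uA pA up; apply/cvgrPdist_lt => e e0.
  have p2 : (u k).2 @[k --> \oo] --> p.2 by exact: (cvg_comp _ _ up cvg_snd).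
  have [T [pT uT]] := cvg_seq_ub p2.
  have [N HN] : exists N, 2 * M * 2^-1 ^+ N * expR (2 * T) < e / 3.
    apply: contrapT => nN; have : e / 3 <= 0; last by apply/negP; rewrite -ltNge divr_gt0.
    apply: (@le_geometric_le0 _ (2 * M * expR (2 * T))) => k.
    by rewrite mulrAC leNgt; apply/negP => h; apply: nN; exists k.
  have HT q : cyl A q -> q.2 <= T -> `|f N q - z q| < e / 3.
    move=> Aq qT; apply: le_lt_trans (fz N q Aq) (le_lt_trans _ HN).
    by rewrite ler_wpM2l ?mulr_ge0 ?exprn_ge0// ler_expR ler_wpM2l.
  have := (af N).1 u p uA pA up => /cvgrPdist_lt/(_ (e / 3)); rewrite divr_gt0// => /(_ erefl).
  apply: filterS => k; have := HT _ (uA k) (uT k); have := HT _ pA pT.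
  rewrite !ltr_norml; lra.
- move=> x t Ax t0; rewrite -subr_le0.
  apply: (@le_geometric_le0 _ (2 * M * wt (x, t))) => k.
  have Ap : cyl A (x, t) by split => //=; rewrite in_itv/= t0.
  have := fz k _ Ap; have := (af k).2 x t Ax t0.
  have := lerB_dist (z (x, t)) (f k (x, t)); rewrite distrC; lra.
Qed.

Lemma exists_mild : exists z, admissible z /\
  forall p, cyl A p -> mild_map z p = z p.
Proof.
apply: (@picard_fixpoint _ _ (cyl A) wt admissible mild_map (fun=> 0) M).
- by move=> p; exact: expR_ge0.
- exact: M0.
- exact: admissible_mild_map.
- exact: mild_map_contract.
- split; first by move=> u p _ _ _; exact: cvg_cst.
  by move=> x t _ _; rewrite normr0 mulr_ge0// expR_ge0.
- move=> [x t] [Ax]; rewrite /= in_itv/= andbT => t0; rewrite subr0.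
  have a0 : admissible (fun=> 0).
    split; first by move=> u p _ _ _; exact: cvg_cst.
    by move=> y s _ _; rewrite normr0 mulr_ge0// expR_ge0.
  apply: le_trans ((admissible_mild_map a0).2 x t Ax t0) _.
  by rewrite ler_wpM2l// ler_expR ler_peMl// ler1n.
- exact: admissible_closed.
Qed.

End existence.

End nonlocal.

(** * Existence and uniqueness for the Dirichlet problem *)

Section dirichlet.
Context {R : realType} {n : nat}.
Local Notation Rn := 'rV[R]_n.
Variables (Omega : set Rn) (mu : Rn -> R).
Hypotheses (hO : regular_domain Omega) (dmu : is_density mu).
Variables (u0 : Rn -> R) (phi : Rn * R -> R).
Local Notation A := (closure Omega).
Local Notation ext := (ext_frontier mu Omega).
Hypotheses (cphi : seqcont (cyl ext) phi) (bphi : tbounded ext phi).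

Let oO : open Omega. Proof. by have [] := hO. Qed.
Let bO : bounded_set Omega. Proof. by have [] := hO. Qed.

Lemma nonlocal_opE v p :
  nonlocal_op mu Omega phi v p = avg mu Omega v p + avg mu ext phi p - v p.
Proof. by case: p. Qed.

Lemma seqcont_nonlocal_op v : seqcont (cyl A) v -> tbounded A v ->
  seqcont (cyl A) (nonlocal_op mu Omega phi v).
Proof.
move=> cv bv; have cv' := seqcontS (@cyl_domainS _ _ Omega) cv.
have bv' := tboundedS (@subset_closure _ Omega) bv.
have c1 := seqcont_avg_domain hO dmu cv' bv'.
have c2 := seqcont_avg_ext hO dmu cphi bphi.
rewrite (_ : nonlocal_op _ _ _ _ = fun p => avg mu Omega v p + avg mu ext phi p - v p); last first.
  by apply/funext => p; exact: nonlocal_opE.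
exact: seqcontB (seqcontD c1 c2) cv.
Qed.

Lemma tbounded_nonlocal_op v : seqcont (cyl A) v -> tbounded A v ->
  tbounded A (nonlocal_op mu Omega phi v).
Proof.
move=> cv bv; have cv' := seqcontS (@cyl_domainS _ _ Omega) cv.
have bv' := tboundedS (@subset_closure _ Omega) bv.
have b1 := tbounded_avg Omega dmu (measurable_domain hO) cv' bv' (mass_domain_le1 hO dmu).
have b2 := tbounded_avg Omega dmu (measurable_ext_frontier mu hO) cphi bphi (mass_ext_le1 hO dmu).
move=> T; have [B1 h1] := b1 T; have [B2 h2] := b2 T; have [B3 h3] := bv T.
exists (B1 + B2 + B3) => x t Ax tT; rewrite nonlocal_opE.
apply: le_trans (ler_normB _ _) _; apply: lerD; last exact: h3.
by apply: le_trans (ler_normD _ _) _; apply: lerD; [exact: h1|exact: h2].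
Qed.

Lemma solution_mild v x (t : R) : seqcont (cyl A) v -> tbounded A v ->
  dirichlet_solution mu Omega u0 phi v -> Omega x -> 0 <= t ->
  v (x, t) = u0 x + prim (nonlocal_op mu Omega phi v) (x, t).
Proof.
move=> cv bv [_ dv v0] Ox t0; rewrite -(v0 x Ox).
have cv' := seqcontS (@cyl_domainS _ _ Omega) cv.
have bv' := tboundedS (@subset_closure _ Omega) bv.
apply: (distr_mild oO bO cv' bv') => //.
- exact: seqcontS (@cyl_domainS _ _ Omega) (seqcont_nonlocal_op cv bv).
- exact: tboundedS (@subset_closure _ Omega) (tbounded_nonlocal_op cv bv).
Qed.

(** Gronwall's argument in iterated form: K_phi(v) - K_phi(u) is bounded by twice
    the supremum of d, and integration of e^(4s) divides by 4. *)
Lemma solution_unique u v (B : R) :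
  seqcont (cyl A) u -> (forall p, cyl A p -> `|u p| <= B) ->
  seqcont (cyl A) v -> (forall p, cyl A p -> `|v p| <= B) ->
  dirichlet_solution mu Omega u0 phi u -> dirichlet_solution mu Omega u0 phi v ->
  forall x t, A x -> 0 <= t -> v (x, t) = u (x, t).
Proof.
move=> cu uB cv vB su sv.
have cylP (x : Rn) (t : R) : A x -> 0 <= t -> cyl A (x, t).
  by move=> Ax t0; split => //=; rewrite in_itv/= t0.
have bu : tbounded A u by move=> T; exists B => x t Ax /andP[t0 _]; apply/uB/cylP.
have bv : tbounded A v by move=> T; exists B => x t Ax /andP[t0 _]; apply/vB/cylP.
have cu' := seqcontS (@cyl_domainS _ _ Omega) cu.
have bu' := tboundedS (@subset_closure _ Omega) bu.
have cv' := seqcontS (@cyl_domainS _ _ Omega) cv.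
have bv' := tboundedS (@subset_closure _ Omega) bv.
pose d p := v p - u p.
have cd : seqcont (cyl Omega) d.
  exact: seqcontB.
have cK := seqcont_nonlocal_op cu bu; have cK' := seqcont_nonlocal_op cv bv.
have cKd : seqcont (cyl A) (fun p => nonlocal_op mu Omega phi v p - nonlocal_op mu Omega phi u p).
  exact: seqcontB.
have gron N : 0 <= N ->
   (forall x t, Omega x -> 0 <= t -> `|d (x, t)| <= N * expR (4 * t)) ->
   forall x t, Omega x -> 0 <= t -> `|d (x, t)| <= N / 2 * expR (4 * t).
  move=> N0 dN x t Ox t0; have Ax := subset_closure Ox.
  rewrite /d (solution_mild cu bu su Ox t0) (solution_mild cv bv sv Ox t0).
  rewrite opprD addrACA subrr add0r (@primB _ _ Omega)//.
  have sb s : 0 <= s <= t -> `|nonlocal_op mu Omega phi v (x, s) -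
      nonlocal_op mu Omega phi u (x, s)| <= N * 2 * expR (4 * s).
    move=> /andP[s0 _]; rewrite !nonlocal_opE.
    have -> : forall a b c a' c' : R, a + b - c - (a' + b - c') = (a - a') - (c - c').
      by move=> *; ring.
    rewrite (avgB dmu)//; last exact: measurable_domain.
    apply: le_trans (ler_normB _ _) _.
    have h1 : `|avg mu Omega d (x, s)| <= N * expR (4 * s) * mass mu Omega x.
      apply: avg_bound => //; first exact: measurable_domain.
      by move=> y Oy; exact: dN.
    have h2 := dN x s Ox s0.
    have h3 := ler_wpM2l (mulr_ge0 N0 (expR_ge0 (4 * s))) (mass_domain_le1 hO dmu x).
    by move: h1 h2 h3; rewrite /d; lra.
  apply: le_trans (prim_bound Ax cKd (ltr0n _ 4) t0 sb) _; lra.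
have d0 x t : Omega x -> 0 <= t -> d (x, t) = 0.
  move=> Ox t0; apply/eqP; rewrite -normr_le0.
  have B0 : 0 <= B by apply: le_trans (uB _ (cylP _ _ (subset_closure Ox) t0)).
  apply: (@le_geometric_le0 _ (2 * B * expR (4 * t))) => k.
  rewrite mulrAC; elim: k x t Ox t0 => [|k IH] x t Ox t0.
    rewrite expr0 mulr1; apply: le_trans (ler_normB _ _) _.
    have := uB _ (cylP _ _ (subset_closure Ox) t0).
    have := vB _ (cylP _ _ (subset_closure Ox) t0).
    have : 1 <= expR (4 * t) by rewrite -expR0 ler_expR mulr_ge0.
    move=> /(ler_wpM2l (mulr_ge0 (ler0n R 2) B0)); lra.
  rewrite exprSr mulrA; apply: gron => //.
  by rewrite mulr_ge0 ?mulr_ge0 ?exprn_ge0.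
move=> x t Ax t0; have [xk [xO xkx]] := closure_seq Ax.
have pk : (xk k, t) @[k --> \oo] --> (x, t).
  exact: (cvg_pair xkx (@cvg_cst _ t _ \oo _)).
have Axk k : cyl A (xk k, t) by apply: cylP => //; exact: subset_closure.
have l1 := cu _ _ Axk (cylP _ _ Ax t0) pk.
have l2 := cv _ _ Axk (cylP _ _ Ax t0) pk.
have e : (fun k => v (xk k, t)) = (fun k => u (xk k, t)).
  by apply/funext => k; apply/eqP; rewrite -subr_eq0; apply/eqP; exact: d0.
rewrite e in l2; exact: (cvg_unique _ l2 l1).
Qed.

(** u = e^(-t) z for the fixed point z: then |u| <= M, and the product rule turns
    the equation of z into that of u. *)
Lemma solution_exists (M : R) : 0 <= M -> {within A, continuous u0} ->
  (forall x, A x -> `|u0 x| <= M) -> (forall p, cyl ext p -> `|phi p| <= M) ->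
  exists u, [/\ seqcont (cyl A) u, forall p, cyl A p -> `|u p| <= M &
    dirichlet_solution mu Omega u0 phi u].
Proof.
move=> M0 cu0 u0M phiM.
have [z [az zE]] := exists_mild hO dmu M0 cu0 u0M cphi phiM.
have [cz zM] := az.
have [cz' bz'] := admissible_domain az.
pose u p := expR (- p.2) * z p.
have cu : seqcont (cyl A) u.
  apply: seqcontM cz; apply: (@seqcont_time _ _ _ (fun t => expR (- t))) => t.
  by apply: continuous_comp; [exact: oppr_continuous|exact: continuous_expR].
have uM p : cyl A p -> `|u p| <= M.
  case: p => x t [/= Ax]; rewrite in_itv/= andbT => t0.
  rewrite /u normrM/= ger0_norm ?expR_ge0// expRN mulrC ler_pdivrMr ?expR_gt0//.
  exact: zM.
exists u; split => //.
have bu : tbounded A u.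
  by move=> T; exists M => x t Ax /andP[t0 _]; apply: uM; split => //=; rewrite in_itv/= t0.
have cu' := seqcontS (@cyl_domainS _ _ Omega) cu.
have bu' := tboundedS (@subset_closure _ Omega) bu.
have cK := seqcont_nonlocal_op cu bu; have bK := tbounded_nonlocal_op cu bu.
have cs := seqcont_source hO dmu cphi phiM az.
split.
- exact: seqcont_within_continuous cu'.
- move=> psi tpsi.
  have := @classical_distr R n Omega psi tpsi u (nonlocal_op mu Omega phi u) oO bO cu' bu'
    (seqcontS (@cyl_domainS _ _ Omega) cK) (tboundedS (@subset_closure _ Omega) bK) _.
  move=> /(_ _)/eqP; rewrite addrC addr_eq0 => H.
  apply/esym/eqP; apply: H => x t Ox t0; have Ax := subset_closure Ox.
  have dz : is_derive t 1 (fun s : R => z (x, s)) (source Omega mu phi z (x, t)).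
    have Hn : \forall s \near t, (cst (u0 x) + (fun s => prim (source Omega mu phi z) (x, s))) s = z (x, s).
      have : \forall s \near t, 0 < s by exact: lt_nbhsr.
      apply: filterS => s s0; rewrite -zE//; split => //=; by rewrite in_itv/= ltW.
    apply: (near_eq_is_derive Hn); rewrite -[X in is_derive _ _ _ X]add0r.
    apply: is_deriveD; exact: is_derive_prim cs t0.
  have de : is_derive t 1 (fun s : R => expR (- s)) (- expR (- t)).
    have := is_derive_expRM (-1 : R) t.
    by under eq_fun do rewrite mulN1r; rewrite !mulN1r.
  have := is_deriveM de dz; congr (is_derive _ _ _ _).
  rewrite nonlocal_opE /source /GRing.scale/= /u.
  rewrite (avgZ dmu (fun t => expR (- t)) x (measurable_domain hO) (ltW t0) cz' bz')/=.
  have e1 := expRxMexpNx_1 t.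
  rewrite mulrDr mulrA (mulrC (expR (- t)) (expR t)) e1 mul1r; ring.
- move=> x Ox; have Ax := subset_closure Ox.
  rewrite /u/= oppr0 expR0 mul1r -zE; last by split => //=; rewrite in_itv/= lexx.
  by rewrite /mild_map prim0 addr0.
Qed.

End dirichlet.

Theorem theorem3p1 (R : realType) (n : nat)
    (Omega : set 'rV[R]_n) (mu : 'rV[R]_n -> R)
    (hOmega : regular_domain Omega) (hmu : is_density mu)
    (u0 : 'rV[R]_n -> R) (phi : 'rV[R]_n * R -> R)
    (hu0 : Cb (closure Omega) u0)
    (hphi : Cb (ext_frontier mu Omega `*` `[(0 : R), +oo[) phi)
    (hcompat : forall x, (boundary Omega `&` ext_frontier mu Omega) x ->
      u0 x = phi (x, 0)) :
  exists u : 'rV[R]_n * R -> R,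
    [/\ Cb (closure Omega `*` `[(0 : R), +oo[) u,
        dirichlet_solution mu Omega u0 phi u &
        forall v : 'rV[R]_n * R -> R,
          Cb (closure Omega `*` `[(0 : R), +oo[) v ->
          dirichlet_solution mu Omega u0 phi v ->
          forall x t, closure Omega x -> 0 <= t -> v (x, t) = u (x, t)].
Proof.
have [cu0 /bounded_near_ex[M1 M10 u0M]] := hu0.
have [/within_continuous_seqcont cphi /bounded_near_ex[M2 M20 phiM]] := hphi.
have bphi : tbounded (ext_frontier mu Omega) phi.
  move=> T; exists M2 => x t Ex /andP[t0 _]; apply: phiM; split => //=.
  by rewrite in_itv/= t0.
pose M := Num.max M1 M2.
have [||||u [cu uM su]] := @solution_exists R n Omega mu hOmega hmu u0 phi cphi bphi M.
- by rewrite le_max M10.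
- exact: cu0.
- by move=> x Ax; rewrite le_max u0M.
- by move=> p Ep; rewrite le_max phiM// orbT.
have M0 : 0 <= M by rewrite le_max M10.
exists u; split => //.
  split; first exact: seqcont_within_continuous.
  by apply/bounded_near_ex; exists M.
move=> v [/within_continuous_seqcont cv /bounded_near_ex[M3 M30 vM]] sv.
apply: (@solution_unique R n Omega mu hOmega hmu u0 phi cphi bphi u v (Num.max M M3)) => //.
- by move=> p Ap; rewrite le_max uM.
- by move=> p Ap; rewrite le_max vM// orbT.
Qed.
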